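(* Let $\beta$ be a Pisot number. Then $$\gamma(\beta)\ \ge\ \inf\bigg(\{1\}\cup\bigcup_{v\in V}\big\{x\in\mathbb{Q}\cap[v,\widehat{v}):\ \delta'_\infty(v-x)\in\pi'_\infty\big(Z'\setminus\mathcal{R}(v)\big)\big\}\bigg).$$ If moreover $\overline{\delta_{\mathrm{f}}(\mathbb{Q})}=\mathbb{K}_{\mathrm{f}}$, then equality holds.
   Context: A Pisot number is a real algebraic integer $\beta>1$ all of whose other Galois conjugates have absolute value less than $1$. The $\beta$-transformation is $T:[0,1)\to[0,1)$, $T(x)=\beta x-\lfloor\beta x\rfloor$; $T^{-k}(x)=\{y\in[0,1): T^k(y)=x\}$. $\mathrm{Pur}(\beta)=\{x\in[0,1):T^k(x)=x\text{ for some }k\ge1\}$. With $N(\beta)$ the norm of the algebraic number $\beta$, $\mathbb{Z}_{N(\beta)}=\{p/q\in\mathbb{Q}:\gcd(q,N(\beta))=1\}$, and $$\gamma(\beta)=\sup\{r\in[0,1]:\mathbb{Z}_{N(\beta)}\cap[0,r)\subseteq\mathrm{Pur}(\beta)\}.$$ Representation spaces: let $K=\mathbb{Q}(\beta)$; for a prime (place) $\mathfrak{p}$ of $K$, $K_\mathfrak{p}$ is the completion of $K$ at $\mathfrak{p}$. Put $\mathbb{K}_{\mathrm{f}}=\prod_{\mathfrak{p}\mid(\beta)}K_\mathfrak{p}$. Let $\mathfrak{p}_1$ be the infinite prime given by the identity embedding $\mathbb{Q}(\beta)\subset\mathbb{R}$, $\mathbb{K}'_\infty=\prod_{\mathfrak{p}\mid\infty,\,\mathfrak{p}\ne\mathfrak{p}_1}K_\mathfrak{p}$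 and $\mathbb{K}'_\beta=\mathbb{K}'_\infty\times\mathbb{K}_{\mathrm{f}}$, with product topologies. The diagonal embeddings of $K$ into $\mathbb{K}'_\beta,\mathbb{K}'_\infty,\mathbb{K}_{\mathrm{f}}$ are $\delta',\delta'_\infty,\delta_{\mathrm{f}}$; $\pi'_\infty:\mathbb{K}'_\beta\to\mathbb{K}'_\infty$ is the canonical projection. $Z'=\mathbb{K}'_\infty\times\overline{\delta_{\mathrm{f}}(\mathbb{Z}[\beta])}$. Let $T^k(1^-)=\lim_{x\to1,\,x<1}T^k(x)$, $\widehat{V}=\{T^k(1^-):k\ge0\}$ (so $1\in\widehat V$) and $V=(\widehat{V}\cup\{0\})\setminus\{1\}$; these sets are finite. For $x\in[0,1)$, $\widehat{x}=\min\{y\in\widehat{V}:y>x\}$. Tiles: for $x\in\mathbb{Z}[\beta^{-1}]\cap[0,1)$, $\mathcal{R}(x)=\lim_{k\to\infty}\delta'(\beta^k\,T^{-k}(x))\subseteq\mathbb{K}'_\beta$ (limit in Hausdorff distance). *)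

(* Defs.v *)
From HB Require Import structures.
From mathcomp Require Import all_boot all_order all_algebra.
From mathcomp Require Import generic_quotient ring lra complex.
From mathcomp Require Import all_classical all_reals all_analysis.

Set Implicit Arguments.
Unset Strict Implicit.
Unset Printing Implicit Defensive.

Import Order.TTheory GRing.Theory Num.Theory.
Import numFieldNormedType.Exports.

Local Open Scope classical_set_scope.
Local Open Scope ring_scope.
Local Open Scope complex_scope.

Section AlgebraicNumbers.
Variables (R : realType) (b : R).

Definition minpoly : {poly rat} :=
  xget 0 [set q : {poly rat} |
    [/\ q \is monic, irreducible_poly q & root (map_poly ratr q) b]].

(* The Galois conjugates of an algebraic [b], itself included: the complex
   roots of its minimal polynomial. *)
Definition conjugates : seq R[i] :=
  sval (closed_field_poly_normal (map_poly ratr minpoly : {poly R[i]})).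

Definition pisot : Prop :=
  [/\ 1 < b, integralOver (intr : int -> R) b
    & forall z : R[i], z \in conjugates -> z != b%:C -> `|z| < 1].

Definition alg_norm : R[i] := \prod_(z <- conjugates) z.

(* For [b] an algebraic integer, [alg_norm] is a rational integer [N]. *)
Definition ZN : set rat :=
  [set x | exists p q N : int,
    [/\ q != 0, x = p%:~R / q%:~R, N%:~R = alg_norm & coprimez q N]].

Definition T (x : R) : R := b * x - (Num.floor (b * x))%:~R.

Definition Tpre (k : nat) (x : R) : set R :=
  [set y | 0 <= y < 1 /\ iter k T y = x].

Definition Pur : set R :=
  [set x | 0 <= x < 1 /\ exists2 k : nat, (0 < k)%N & iter k T x = x].

Definition gamma : R :=
  sup [set r : R | 0 <= r <= 1 /\
    forall x : rat, ZN x -> 0 <= (ratr x : R) < r -> Pur (ratr x)].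

Definition T1minus (k : nat) : R := lim (iter k T x @[x --> 1^'-]).

Definition Vhat : set R := range T1minus.

Definition V : set R := (Vhat `|` [set 0]) `\ 1.

(* The set is finite and contains 1, so the infimum is a minimum. *)
Definition hat (x : R) : R := inf [set y | Vhat y /\ x < y].

(* The smallest subfield of [R] containing [b]. *)
Definition Qadj : {pred R} := [pred x | `[< forall S : {pred R},
  divring_closed S -> b \in S -> x \in S >]].

Fact Qadj_divring : divring_closed Qadj.
Proof.
split.
- by apply/asboolP => S [S1 _ _] _.
- move=> x y /asboolP xS /asboolP yS; apply/asboolP => S Sr bS.
  by case: (Sr) => _ SB _; apply: SB; [exact: xS|exact: yS].
- move=> x y /asboolP xS /asboolP yS; apply/asboolP => S Sr bS.
  by case: (Sr) => _ _ SV; apply: SV; [exact: xS|exact: yS].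
Qed.

HB.instance Definition _ := GRing.isDivringClosed.Build R Qadj Qadj_divring.

Record Qbeta := MkQbeta { Qval : R ; Qval_adj : Qval \in Qadj }.

HB.instance Definition _ := [isSub for Qval].
HB.instance Definition _ := [Choice of Qbeta by <:].
HB.instance Definition _ := [SubChoice_isSubComUnitRing of Qbeta by <:].
HB.instance Definition _ := [SubComUnitRing_isSubIntegralDomain of Qbeta by <:].
HB.instance Definition _ := [SubIntegralDomain_isSubField of Qbeta by <:].

Fact gen_subproof : b \in Qadj. Proof. by apply/asboolP => S _. Qed.

Definition beta : Qbeta := MkQbeta gen_subproof.

Definition Zbeta : set Qbeta :=
  [set x | exists p : {poly int}, x = (map_poly intr p).[beta]].

End AlgebraicNumbers.

Arguments Zbeta {R} b _.

Record absval (R : realType) (K : fieldType) := AbsVal {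
  absv :> K -> R ;
  absv_ge0 : forall x, 0 <= absv x ;
  absv_eq0 : forall x, (absv x == 0) = (x == 0) ;
  absvM : forall x y, absv (x * y) = absv x * absv y ;
  absvD : forall x y, absv (x + y) <= absv x + absv y }.

Section Completion.
Variables (R : realType) (K : fieldType) (w : absval R K).
Implicit Types u v t : nat -> K.

Lemma absv0 : w 0 = 0. Proof. by apply/eqP; rewrite absv_eq0. Qed.

Lemma absv1 : w 1 = 1.
Proof.
have w1 : w 1 != 0 by rewrite absv_eq0 oner_eq0.
by apply: (mulfI w1); rewrite -absvM !mulr1.
Qed.

Lemma absvN x : w (- x) = w x.
Proof.
have wN1 : w (-1) = 1.
  apply/eqP; rewrite -(eqrXn2 (n := 2)) ?absv_ge0 ?ler01//.
  by rewrite expr2 -absvM mulrNN mulr1 absv1 expr1n.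
by rewrite -mulN1r absvM wN1 mul1r.
Qed.

Lemma absv_distC x y : w (x - y) = w (y - x).
Proof. by rewrite -opprB absvN. Qed.

Lemma absv_dist_triangle y x z : w (x - z) <= w (x - y) + w (y - z).
Proof. by rewrite -[x - z](subrKA y) absvD. Qed.

Definition absv_cauchy u : Prop :=
  forall e : R, 0 < e ->
    exists N, forall m n, (N <= m)%N -> (N <= n)%N -> w (u m - u n) < e.

Record cauchy_seq := CauchySeq {
  cseq :> nat -> K ; cseqP : `[< absv_cauchy cseq >] }.

HB.instance Definition _ := [isSub for cseq].
HB.instance Definition _ := [Choice of cauchy_seq by <:].

Implicit Types x y z : cauchy_seq.

Definition seq_dist x y : R := limn (fun n => w (x n - y n)).

Lemma seq_dist_cvg x y : cvgn (fun n => w (x n - y n)).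
Proof.
apply/cauchy_cvgP/cauchy_exP => e e0.
have e20 : 0 < e / 2 by rewrite divr_gt0.
have [N1 xN] := asboolW (cseqP x) _ e20.
have [N2 yN] := asboolW (cseqP y) _ e20.
pose N := maxn N1 N2; exists (w (x N - y N)); exists N => // n /= Nn.
have {xN} xN : w (x N - x n) < e / 2.
  by apply: xN; [exact: leq_maxl|exact: leq_trans (leq_maxl _ _) Nn].
have {yN} yN : w (y N - y n) < e / 2.
  by apply: yN; [exact: leq_maxr|exact: leq_trans (leq_maxr _ _) Nn].
rewrite -ball_normE /= ltr_norml; apply/andP; split.
  rewrite ltrNl opprB ltrBlDr.
  have := absv_dist_triangle (x N) (x n) (y n).
  have := absv_dist_triangle (y N) (x N) (y n).
  rewrite absv_distC in xN.
  lra.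
have := absv_dist_triangle (x n) (x N) (y N).
have := absv_dist_triangle (y n) (x n) (y N).
rewrite absv_distC in yN.
lra.
Qed.

Lemma seq_dist_refl x : seq_dist x x = 0.
Proof.
rewrite /seq_dist (_ : (fun n => _) = cst 0) ?lim_cst//.
by apply/funext => n; rewrite subrr absv0.
Qed.

Lemma seq_dist_sym x y : seq_dist x y = seq_dist y x.
Proof.
by rewrite /seq_dist; congr (limn _); apply/funext => n; rewrite absv_distC.
Qed.

Lemma seq_dist_triangle y x z : seq_dist x z <= seq_dist x y + seq_dist y z.
Proof.
rewrite /seq_dist -limD; [|exact: seq_dist_cvg..].
apply: ler_lim; [exact: seq_dist_cvg|apply: is_cvgD; exact: seq_dist_cvg|].
by near=> n; exact: absv_dist_triangle.
Unshelve. all: by end_near. Qed.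

Lemma seq_dist_ge0 x y : 0 <= seq_dist x y.
Proof.
apply: limr_ge; first exact: seq_dist_cvg.
by near=> n; exact: absv_ge0.
Unshelve. all: by end_near. Qed.

Definition cseq_equiv : rel cauchy_seq := fun x y => seq_dist x y == 0.

Lemma cseq_equiv_is_equiv : equiv_class_of cseq_equiv.
Proof.
split=> [x|x y|y x z]; rewrite /cseq_equiv.
- by rewrite seq_dist_refl eqxx.
- by rewrite seq_dist_sym.
- move=> /eqP xy /eqP yz; rewrite eq_le seq_dist_ge0 andbT.
  by rewrite (le_trans (seq_dist_triangle y _ _))// xy yz addr0.
Qed.

Canonical cseq_equiv_rel := EquivRelPack cseq_equiv_is_equiv.

(* The completion of [K] at [w]: Cauchy sequences modulo null sequences, with
   the metric extending [w (x - y)]. *)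
Definition completion : Type := {eq_quot cseq_equiv}%qT.

HB.instance Definition _ := Choice.on completion.
HB.instance Definition _ := Quotient.on completion.

Implicit Types p q r : completion.

Definition completion_dist p q : R := seq_dist (repr p) (repr q).

Lemma completion_distxx p : completion_dist p p = 0.
Proof. exact: seq_dist_refl. Qed.

Lemma completion_dist_positivity p q : completion_dist p q = 0 -> p = q.
Proof.
rewrite -{2}(reprK p) -{2}(reprK q) => /eqP pq.
exact/eqmodP.
Qed.

Lemma completion_dist_sym p q : completion_dist p q = completion_dist q p.
Proof. exact: seq_dist_sym. Qed.

Lemma completion_dist_triangle q p r :
  completion_dist p r <= completion_dist p q + completion_dist q r.
Proof. exact: seq_dist_triangle. Qed.

HB.instance Definition _ := @isMetric.Build R completion completion_dist
  completion_distxx completion_dist_positivity completion_dist_sym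
  completion_dist_triangle.

Lemma cst_cauchy (a : K) : `[< absv_cauchy (fun=> a) >].
Proof. by apply/asboolP => e e0; exists 0%N => m n _ _; rewrite subrr absv0. Qed.

Definition to_completion (a : K) : completion :=
  (\pi_completion (CauchySeq (cst_cauchy a)))%qT.

End Completion.

Section Places.
Variables (R : realType) (K : fieldType).
Implicit Types w : absval R K.

(* An infinite prime is a complex embedding up to conjugation, i.e. the
   absolute value it induces. *)
Definition infinite_place w : Prop :=
  exists s : {rmorphism K -> R[i]}, forall x, (w x)%:C = `|s x|.

(* A finite prime is a discrete valuation [v : K^* ->> Z], normalized as
   [2 ^ (- v x)].  The base only matters up to equivalence of absolute values,
   which changes neither the completion nor its topology. *)
Definition finite_place w : Prop :=
  [/\ forall x y, w (x + y) <= Num.max (w x) (w y),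
      forall x, x != 0 -> exists n : int, w x = 2 ^ n
    & exists x, w x = 2^-1].

End Places.

Section RepresentationSpace.
Variables (R : realType) (b : R).

Let K : fieldType := Qbeta b.

Definition is_p1 (w : absval R K) : Prop := forall x : K, w x = `|Qval x|.

(* The infinite primes other than that of the identity embedding. *)
Definition places_inf' : Type :=
  {w : absval R K | infinite_place w /\ ~ is_p1 w}.

(* The primes dividing [(b)]: those with [v b > 0]. *)
Definition places_f : Type :=
  {w : absval R K | finite_place w /\ w (beta b) < 1}.

Definition Kinf' := prod_topology (fun p : places_inf' => completion (sval p)).
Definition Kf := prod_topology (fun p : places_f => completion (sval p)).
Definition Kbeta' : topologicalType := (Kinf' * Kf)%type.

Definition delta_inf' (x : K) : Kinf' := fun p => to_completion (sval p) x.
Definition delta_f (x : K) : Kf := fun p => to_completion (sval p) x.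
Definition delta' (x : K) : Kbeta' := (delta_inf' x, delta_f x).

Definition pi_inf' (z : Kbeta') : Kinf' := z.1.

Definition Z' : set Kbeta' := setT `*` closure (delta_f @` Zbeta b).

(* The maximum of the local distances, over a finite set of primes. *)
Definition Kdist (y z : Kbeta') : \bar R :=
  ereal_sup ([set 0%E]
    `|` [set (mdist (y.1 p) (z.1 p))%:E | p in [set: places_inf']]
    `|` [set (mdist (y.2 p) (z.2 p))%:E | p in [set: places_f]]).

Definition hausdorff_dist (A B : set Kbeta') : \bar R :=
  maxe (ereal_sup [set ereal_inf [set Kdist y z | z in B] | y in A])
       (ereal_sup [set ereal_inf [set Kdist y z | y in A] | z in B]).

(* [delta' (b^k T^{-k}(x))]; for [x] in [Q(b)] all of [T^{-k}(x)] lies in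
   [Q(b)]. *)
Definition tile_approx (x : K) (k : nat) : set Kbeta' :=
  [set delta' y | y in
    [set y : K | exists2 u, Tpre b k (Qval x) u & Qval y = b ^+ k * u]].

(* The Hausdorff distance separates closed sets, so the limit is unique. *)
Definition tile (x : K) : set Kbeta' :=
  xget set0 [set A | closed A /\
    hausdorff_dist (tile_approx x k) A @[k --> \oo] --> 0%E].

(* [{x in Q cap [v, hat v) : delta_inf' (v - x) in pi_inf' (Z' \ tile v)}] *)
Definition exceptional (v : K) : set R :=
  [set ratr x | x in [set x : rat |
    Qval v <= ratr x < hat b (Qval v) /\
    (pi_inf' @` (Z' `\` tile v)) (delta_inf' (v - ratr x))]].

End RepresentationSpace.

Arguments delta_f {R} b _.

(* Main.v *)
From HB Require Import structures.
Require Import Defs.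
From mathcomp Require Import all_boot all_order all_algebra.
From mathcomp Require Import generic_quotient ring lra zify complex.
From mathcomp Require Import all_classical all_reals all_analysis.

Set Implicit Arguments.
Unset Strict Implicit.
Unset Printing Implicit Defensive.

Import Order.TTheory GRing.Theory Num.Theory.
Import numFieldNormedType.Exports.
Local Open Scope classical_set_scope.
Local Open Scope ring_scope.

(** Let [x] be rational with [v <= x < hat v], where [v] is in [V].
   Everything rests on the criterion of Ito-Rao and Berthe-Siegel: [x] is purely
   periodic exactly when [delta' (v - x)] lies in the tile of [v].

   The tile of [v] is the closure of the increasing union of the sets
   [delta' (beta^k T^-k(v))] ([tileE]): [beta] contracts at all primes of the
   representation space, so the approximations converge geometrically.  As no
   element of [Vhat] lies between [v] and [x], the set [beta^k T^-k(x)] is the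
   translate of [beta^k T^-k(v)] by [x - v] ([Tpre_shift]).  If [T^n(x) = x], then
   [beta^(nm) x] belongs to [beta^(nm) T^-(nm)(x)] and tends to 0, so that [v - x]
   is in the tile ([pure_tile]).  Conversely, if [v - x] is in the tile, then 0 is
   adherent to the union of the [beta^k T^-k(x)] ([tile_null_point]).  This property
   is inherited by some preimage of [x], hence there is a whole backward orbit with
   it.  Its points lie in [Z[beta, 1/beta]] up to a common denominator, and they are
   bounded at all infinite primes and integral at the primes dividing [beta].  So
   they belong to a finite set, the orbit repeats, and [x] is purely periodic
   ([null_point_pure]).

   The finiteness has two parts.  An element of [Z[beta, 1/beta]] that is integral
   at all primes dividing [beta] is an algebraic integer
   ([integral_of_fin_places]): if not, Chevalley's theorem provides a valuation ring
   that contradicts the hypothesis, and valuation rings of a number field are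
   discrete ([valuation_ring_discrete]).  And algebraic integers of bounded height
   are finite in number ([finite_bounded_integers]); this also shows that [Vhat] is
   finite, so that the intervals from [v] to [hat v] cover the unit interval
   ([V_cover]).

   The lower bound for [gamma] follows, because a number [x] in [ZN] is a limit of
   integers at the primes dividing [beta], whence [delta' (v - x)] lies in [Z'] and
   [x] is exceptional if it is not purely periodic ([ZN_pure_or_exceptional]).  For
   the upper bound, an exceptional [x] comes with a point of [Z'] outside the tile;
   if the rationals are dense at the finite primes, a rational [y] just above [x] can
   be found close to this point, so that [y] is not purely periodic.  It lies in
   [ZN] because it is integral at the primes dividing [beta], and every prime factor
   of the norm lies below one of these ([exceptional_ZN_approx]). *)

(** * Chevalley extension of valuation rings *)

Section ValuationRings.
Variable K : fieldType.
Implicit Types (A B : set K) (x y s t : K) (p q r : {poly K}).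

Definition subring B :=
  [/\ B 1, forall x y, B x -> B y -> B (x - y) & forall x y, B x -> B y -> B (x * y)].

Lemma subring0 B : subring B -> B 0.
Proof. by case=> B1 BB _; rewrite -(subrr 1); apply: BB. Qed.

Lemma subringN B x : subring B -> B x -> B (- x).
Proof. by move=> sB Bx; rewrite -sub0r; case: (sB) => _ BB _; apply: BB => //; apply: subring0. Qed.

Lemma subringD B x y : subring B -> B x -> B y -> B (x + y).
Proof.
by move=> sB Bx By; rewrite -[y]opprK; case: (sB) => _ BB _; apply: BB => //; apply: subringN.
Qed.

Lemma subringX B x n : subring B -> B x -> B (x ^+ n).
Proof.
by move=> sB Bx; case: (sB) => B1 _ BM; elim: n => [|n IH]; rewrite ?expr0 // exprS; apply: BM.
Qed.

Lemma subring_sum B (I : finType) (P : pred I) (F : I -> K) :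
  subring B -> (forall i, P i -> B (F i)) -> B (\sum_(i | P i) F i).
Proof.
move=> sB BF; apply: (big_ind B) => //; first exact: subring0.
by move=> x y; apply: subringD.
Qed.

Lemma subring_int B (m : int) : subring B -> B m%:~R.
Proof.
move=> sB; have Bn n : B n%:R.
  elim: n => [|n IH]; first exact: subring0.
  by rewrite -addn1 natrD; apply: subringD => //; case: sB.
by case: m => n; rewrite ?NegzE ?mulrNz; [|apply: subringN => //]; apply: Bn.
Qed.

Definition ideal2 B s t : set K :=
  [set z | exists u v, [/\ B u, B v & z = s * u + t * v]].

Lemma ideal2B B s t x y : subring B ->
  ideal2 B s t x -> ideal2 B s t y -> ideal2 B s t (x - y).
Proof.
move=> [_ BB _] [u1 [v1 [? ? ->]]] [u2 [v2 [? ? ->]]].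
exists (u1 - u2), (v1 - v2); split; [exact: BB|exact: BB|]; ring.
Qed.

Lemma ideal2M B s t x y : subring B ->
  B x -> ideal2 B s t y -> ideal2 B s t (x * y).
Proof.
move=> [_ _ BM] Bx [u [v [? ? ->]]].
exists (x * u), (x * v); split; [exact: BM|exact: BM|]; ring.
Qed.

Lemma ideal2D B s t x y : subring B ->
  ideal2 B s t x -> ideal2 B s t y -> ideal2 B s t (x + y).
Proof.
move=> sB Ix Iy; rewrite -[y]opprK; apply: ideal2B => //; rewrite -mulN1r.
by apply: ideal2M => //; apply: subringN => //; case: sB.
Qed.

Lemma ideal2_0 B s t : subring B -> ideal2 B s t 0.
Proof. by move=> /subring0 B0; exists 0, 0; rewrite !mulr0 addr0. Qed.

Lemma ideal2_sub B s t x : subring B -> B s -> B t -> ideal2 B s t x -> B x.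
Proof.
move=> sB Bs Bt [u [v [? ? ->]]]; case: (sB) => _ _ BM.
by apply: subringD => //; apply: BM.
Qed.

Definition adjoin B x : set K :=
  [set z | exists p, (forall i, B p`_i) /\ z = p.[x]].

Lemma adjoin_subring B x : subring B -> subring (adjoin B x).
Proof.
move=> sB; case: (sB) => B1 BB BM; split.
- exists 1; split; last by rewrite hornerC.
  by move=> i; rewrite coef1; case: (i == 0)%N => //; apply: subring0.
- move=> _ _ [p [Bp ->]] [q [Bq ->]]; exists (p - q); split; last by rewrite !hornerE.
  by move=> i; rewrite coefB; apply: BB.
- move=> _ _ [p [Bp ->]] [q [Bq ->]]; exists (p * q); split; last by rewrite hornerM.
  by move=> i; rewrite coefM; apply: subring_sum => // j _; apply: BM.
Qed.

Lemma adjoin_sub B x : subring B -> B `<=` adjoin B x.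
Proof.
move=> sB y By; exists y%:P; split; last by rewrite hornerC.
by move=> i; rewrite coefC; case: ifP => // _; apply: subring0.
Qed.

Lemma adjoin_gen B x : subring B -> adjoin B x x.
Proof.
move=> sB; exists 'X; split; last by rewrite hornerX.
by move=> i; rewrite coefX -[_%:R]/((i == 1%N)%:Z%:~R : K); apply: subring_int.
Qed.

(** Turns a failure of properness in [B[x]] into one polynomial relation for [x],
   the form used in the descent below. *)
Lemma ideal2_adjoin B s t x z : subring B -> ideal2 (adjoin B x) s t z ->
  exists r, (forall i, ideal2 B s t r`_i) /\ z = r.[x].
Proof.
move=> sB [_ [_ [[p [Bp ->]] [q [Bq ->]] ->]]].
exists (s *: p + t *: q); split; last by rewrite !hornerE.
by move=> i; rewrite coefD !coefZ; exists p`_i, q`_i.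
Qed.

Lemma maximal_subring A s t : subring A -> ~ ideal2 A s t 1 ->
  exists B, [/\ subring B, A `<=` B, ~ ideal2 B s t 1 &
    forall C, subring C -> B `<=` C -> ~ ideal2 C s t 1 -> C `<=` B].
Proof.
move=> sA A1.
(* The empty set is there for the sake of the empty chain. *)
pose P X := X = set0 \/ [/\ subring X, A `<=` X & ~ ideal2 X s t 1].
have [|B [PB maxB]] := @Zorn_bigcup K P.
  move=> F FP totF.
  have [F0|] := pselect (forall X, F X -> X = set0).
    by left; rewrite -subset0 => x [X FX]; rewrite (F0 _ FX).
  rewrite -existsNP => -[X0 /not_implyP[FX0 X0n]]; right.
  have good X x : F X -> X x -> [/\ subring X, A `<=` X & ~ ideal2 X s t 1].
    by move=> /FP[->|//].
  have [sX0 AX0 _] : [/\ subring X0, A `<=` X0 & ~ ideal2 X0 s t 1].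
    by case: (FP _ FX0).
  have join x y : (\bigcup_(X in F) X) x -> (\bigcup_(X in F) X) y ->
      exists X, [/\ F X, X x & X y].
    move=> [X FX Xx] [Y FY Yy]; have [XY|YX] := totF _ _ FX FY.
      by exists Y; split=> //; apply: XY.
    by exists X; split=> //; apply: YX.
  split.
  - split; first by exists X0 => //; case: sX0.
      move=> x y Ux Uy; have [X [FX Xx Xy]] := join _ _ Ux Uy.
      by exists X => //; have [[_ XB _] _ _] := good _ _ FX Xx; apply: XB.
    move=> x y Ux Uy; have [X [FX Xx Xy]] := join _ _ Ux Uy.
    by exists X => //; have [[_ _ XM] _ _] := good _ _ FX Xx; apply: XM.
  - by move=> x Ax; exists X0 => //; apply: AX0.
  - move=> [u [v [Uu Uv e]]]; have [X [FX Xu Xv]] := join _ _ Uu Uv.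
    by have [_ _ []] := good _ _ FX Xu; exists u, v.
case: PB => [B0|[sB AB B1]].
  exfalso; apply: (maxB A); last by right; split.
  rewrite B0; split; first exact: sub0set.
  by case: sA => A_1 _ _ A0; apply: (A0 1).
exists B; split=> // C sC BC C1.
apply: contrapT => CB; apply: (maxB C); last by right; split=> //; apply: subset_trans BC.
by split.
Qed.

(** Chevalley's extension theorem.  In a subring maximal among those where [s] and
   [t] generate a proper ideal, every [1 - c] with [c] in this ideal is
   invertible.  If neither [x] nor [1/x] belonged to it, there would be relations
   [1 = r(x)] and [1 = q(1/x)] with coefficients in the ideal, and the shorter one
   could be used for ever to shorten the longer one. *)
Lemma chevalley A s t : subring A -> A s -> A t -> ~ ideal2 A s t 1 ->
  exists B, [/\ subring B, A `<=` B, ~ ideal2 B s t 1 &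
    forall x, B x \/ B x^-1].
Proof.
move=> sA As At /(maximal_subring sA)[B [sB AB B1 maxB]]; exists B; split=> //.
case: (sB) => B_1 _ BM.
have Bs := AB _ As; have Bt := AB _ At.
have ext x : ~ B x -> exists r, (forall i, ideal2 B s t r`_i) /\ 1 = r.[x].
  move=> Bx; apply: ideal2_adjoin => //; apply: contrapT => C1; apply: Bx.
  apply: (maxB (adjoin B x)) => //; last exact: adjoin_gen.
    exact: adjoin_subring.
  exact: adjoin_sub.
have unit c : ideal2 B s t c -> 1 - c != 0 /\ B (1 - c)^-1.
  move=> Ic; have u0 : 1 - c != 0.
    by apply/eqP => /eqP; rewrite subr_eq0 => /eqP e; rewrite e in B1.
  split=> //; apply: contrapT => /ext[r [Ir r1]]; apply: B1.
  have Bu : B (1 - c) by case: (sB) => _ BB _; apply: BB => //; apply: ideal2_sub Ic.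
  have IuN N : ideal2 B s t ((1 - c) ^+ N - 1).
    elim: N => [|N IH]; first by rewrite expr0 subrr; apply: ideal2_0.
    have -> : (1 - c) ^+ N.+1 - 1 = ((1 - c) ^+ N - 1) - (1 - c) ^+ N * c.
      by rewrite exprSr; ring.
    by apply: ideal2B => //; apply: ideal2M => //; apply: subringX.
  have Iu : ideal2 B s t ((1 - c) ^+ size r).
    have -> : (1 - c) ^+ size r =
        \sum_(i < size r) (1 - c) ^+ (size r - i) * r`_i.
      rewrite -[LHS]mulr1 [X in _ * X = _]r1 horner_coef mulr_sumr; apply: eq_bigr => i _.
      rewrite mulrCA mulrC; congr (_ * _).
      by rewrite exprVn (expfB_cond (m := size r)) ?(negbTE u0) ?add0n 1?ltnW.
    apply: (big_ind (ideal2 B s t)); first exact: ideal2_0.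
      by move=> x y; apply: ideal2D.
    by move=> i _; apply: ideal2M => //; apply: subringX.
  by rewrite -[1](subKr ((1 - c) ^+ size r)); apply: ideal2B.
have descent n : forall x r q, x != 0 -> (size r + size q <= n)%N ->
    (forall i, ideal2 B s t r`_i) -> (forall i, ideal2 B s t q`_i) ->
    1 = r.[x] -> 1 = q.[x^-1] -> False.
  elim: n => [|n IH] x r q x0.
    rewrite leqn0 addn_eq0 => /andP[/eqP r0 _] _ _ /esym/eqP.
    by rewrite horner_coef r0 big_ord0 eq_sym oner_eq0.
  wlog le_qr : x x0 r q / (size q <= size r)%N.
    move=> WL; have [/WL|/ltnW le_rq] := leqP (size q) (size r); first exact.
    move=> rqn Ir Iq r1 q1; apply: (WL x^-1 _ q r) => //; first by rewrite invr_eq0.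
      by rewrite addnC.
    by rewrite invrK.
  move=> rqn Ir Iq r1 q1.
  have [u0 Bu] := unit _ (Iq 0).
  have q_gt1 : (1 < size q)%N.
    rewrite ltnNge; apply/negP => q_le1; apply: B1.
    by rewrite q1 (size1_polyC q_le1) hornerC -?(size1_polyC q_le1).
  have [N rN] : exists N, size r = N.+1.
    by exists (size r).-1; rewrite prednK // (leq_trans _ le_qr) // ltnW.
  (* The leading term of [r] is rewritten with the help of the relation
     [1 - q_0 = sum_(j > 0) q_j x^-j]. *)
  pose r' := \poly_(i < N) (r`_i + r`_N / (1 - q`_0) * q`_(N - i)).
  apply: (IH x r' q) => //.
  - by rewrite (leq_trans _ (_ : N + size q <= n)%N) ?leq_add2r ?size_poly // -ltnS -addSn -rN.
  - move=> i; rewrite coef_poly; case: ifP => _; last exact: ideal2_0.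
    apply: ideal2D => //; apply: ideal2M => //; apply: BM => //.
    exact: ideal2_sub (Ir N).
  have qE : \sum_(i < N) q`_(N - i) * x ^+ i = x ^+ N * (1 - q`_0).
    rewrite [X in _ * (X - _)]q1 (@horner_coef_wide _ N.+1); last by rewrite -rN.
    rewrite big_ord_recl expr0 mulr1.
    rewrite addrAC subrr add0r mulr_sumr (reindex_inj rev_ord_inj) /=.
    apply: eq_bigr => i _; rewrite subKn; last exact: ltn_ord.
    rewrite /bump leq0n add1n mulrCA; congr (_ * _).
    by rewrite exprVn (expfB_cond (m := N)) ?(negbTE x0) ?add0n ?ltn_ord.
  rewrite /r' horner_poly.
  under eq_bigr do rewrite mulrDl -mulrA.
  rewrite big_split /= -mulr_sumr qE.
  have -> : r`_N / (1 - q`_0) * (x ^+ N * (1 - q`_0)) = r`_N * x ^+ N by field.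
  by rewrite r1 horner_coef rN big_ord_recr.
move=> x; have [->|x0] := eqVneq x 0; first by left; apply: subring0.
apply: contrapT => /not_orP[/ext[r [Ir r1]] /ext[q [Iq q1]]].
exact: (descent (size r + size q)%N x r q).
Qed.

End ValuationRings.

(** * Valuation rings over a rational prime are discrete *)

Section DiscreteValuation.
Variables (R : realType) (K : fieldType) (B : set K) (l n : nat).
Hypotheses (sB : subring B) (valB : forall x, B x \/ B x^-1).
Hypotheses (l_prime : prime l) (l0 : l%:R != 0 :> K).
Hypothesis lB : forall x, B x -> l%:R * x <> 1.
Hypothesis algK : forall x : K, exists p : {poly int},
  [/\ p != 0, (size p <= n.+1)%N & root (map_poly intr p) x].
Implicit Types (x y z : K) (k : int).

Let L : K := l%:R.

Let B1 : B 1. Proof. by case: sB. Qed.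

Let BM x y : B x -> B y -> B (x * y). Proof. by case: sB => _ _; apply. Qed.

Let BX x m : B x -> B (x ^+ m). Proof. exact: subringX. Qed.

Let BL : B L. Proof. exact: (subring_int l). Qed.

Definition valunit x := [/\ x != 0, B x & B x^-1].

Lemma valunitM x y : valunit x -> valunit y -> valunit (x * y).
Proof.
move=> [x0 Bx Bxi] [y0 By Byi]; split; first by rewrite mulf_neq0.
  exact: BM.
by rewrite invfM; apply: BM.
Qed.

Lemma valunitV x : valunit x -> valunit x^-1.
Proof. by move=> [x0 Bx Bxi]; split; rewrite ?invr_eq0 ?invrK. Qed.

Lemma valunitX x m : valunit x -> valunit (x ^+ m).
Proof.
move=> ux; elim: m => [|m IH]; last by rewrite exprS; apply: valunitM.
by rewrite expr0; split; rewrite ?oner_eq0 ?invr1.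
Qed.

Lemma valunit_coprime (c : int) : coprimez c l -> valunit c%:~R.
Proof.
move=> /coprimezP[[u v] /= uv].
have e : (u%:~R * c%:~R + v%:~R * L : K) = 1.
  by rewrite -[L]/(l%:Z%:~R : K) -!intrM -intrD uv.
have c0 : c%:~R != 0 :> K.
  apply/eqP => c0; apply: (lB (subring_int v sB)).
  by move: e; rewrite c0 mulr0 add0r mulrC.
split=> //; first exact: subring_int.
have [Bq|] := valB (c%:~R / L).
  case: (lB (subringD sB (BM (subring_int u sB) Bq) (subring_int v sB))).
  by rewrite -[RHS]e; field.
rewrite invf_div => Bq.
have -> : c%:~R^-1 = u%:~R + v%:~R * (L / c%:~R) :> K.
  by apply: (mulIf c0); rewrite mulVf // -[LHS]e; field.
by apply: subringD => //; [exact: subring_int|apply: BM => //; exact: subring_int].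
Qed.

Lemma valunit_int (c : int) : c != 0 -> exists a : nat, valunit (c%:~R / L ^+ a).
Proof.
move=> c0; have c_gt0 : (0 < `|c|)%N by rewrite absz_gt0.
have [m cop e] := pfactor_coprime l_prime c_gt0.
exists (logn l `|c|).
have -> : c%:~R / L ^+ logn l `|c| = ((-1) ^+ (c < 0)%R * m%:Z)%:~R :> K.
  rewrite {1}[c]intEsign {1}e PoszM !rmorphM /= -mulrA; congr (_ * _).
  have -> : ((l ^ logn l `|c|)%N%:Z)%:~R = L ^+ logn l `|c| :> K by rewrite /L -natrX.
  by rewrite mulfK // expf_neq0.
apply: valunit_coprime; rewrite coprimezE abszMsign absz_nat.
by rewrite coprime_sym.
Qed.

Lemma valunit_Lz k : valunit (L ^ k) -> k = 0.
Proof.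
have pos m : ~ valunit (L ^+ m.+1).
  move=> [_ _ BLi]; apply: (lB (BM (BX m BL) BLi)).
  by rewrite -/L mulrA -exprS mulfV // expf_neq0.
case: k => [[|m]|m] // uL; first by case: (pos m).
case: (pos m); rewrite -[_ ^+ _]invrK; exact: valunitV.
Qed.

(** The maximal ideal of the valuation ring. *)
Let nonunit x := forall y, B y -> x * y <> 1.

Let nonunitD x y : B x -> B y -> nonunit x -> nonunit y -> nonunit (x + y).
Proof.
wlog Bxy : x y / B (x / y).
  move=> WL Bx By nx ny; have [|] := valB (x / y); first by move=> Bxy; apply: WL.
  by rewrite invf_div addrC => Byx; apply: WL.
have [->|y0] := eqVneq y 0; first by rewrite addr0.
move=> _ _ _ ny z Bz e; apply: (ny ((x / y + 1) * z)).
  by apply: BM => //; apply: subringD.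
by rewrite -[RHS]e; field.
Qed.

Lemma valunit_relation (I : finType) (t : I -> K) : \sum_i t i = 0 ->
  (exists i, t i != 0) -> exists i j, [/\ i != j, t i != 0, t j != 0 & valunit (t j / t i)].
Proof.
move=> t_sum [i1 ti1].
have [i ti imax] : exists2 i, t i != 0 & forall j, B (t j / t i).
  have : forall s : seq I, exists2 i, t i != 0 & forall j, j \in s -> B (t j / t i).
    elim=> [|a s [i ti IH]]; first by exists i1.
    have [ta0|ta] := eqVneq (t a) 0.
      exists i => // j; rewrite inE => /orP[/eqP->|/IH//].
      by rewrite ta0 mul0r; apply: subring0.
    have [Bai|] := valB (t a / t i).
      by exists i => // j; rewrite inE => /orP[/eqP->|/IH//].
    rewrite invf_div => Bia; exists a => // j; rewrite inE => /orP[/eqP->|/IH Bji].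
      by rewrite divff.
    have -> : t j / t a = t j / t i * (t i / t a) by field; rewrite ti ta.
    exact: BM.
  by move=> /(_ (enum I))[i ti H]; exists i => // j; apply: H; rewrite mem_enum.
apply: contrapT => no.
have non j : j != i -> nonunit (t j / t i).
  move=> ji; have [->|tj] := eqVneq (t j) 0.
    by move=> y _; rewrite mul0r mul0r => /eqP; rewrite eq_sym oner_eq0.
  move=> y By e; apply: no; exists i, j; split=> //; first by rewrite eq_sym.
  split; [by rewrite mulf_neq0 ?invr_eq0|exact: imax|].
  suff -> : (t j / t i)^-1 = y by [].
  by apply: (mulfI (_ : t j / t i != 0)); rewrite ?e ?mulfV // mulf_neq0 ?invr_eq0.
have : nonunit (\sum_(j | j != i) t j / t i) /\ B (\sum_(j | j != i) t j / t i).
  apply: (big_ind (fun z => nonunit z /\ B z)).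
  - split; last exact: subring0.
    by move=> y _; rewrite mul0r => /eqP; rewrite eq_sym oner_eq0.
  - by move=> x y [? ?] [? ?]; split; [exact: nonunitD|exact: subringD].
  - by move=> j /non.
case=> /(_ (-1)) + _; apply; first exact: subringN.
rewrite -mulr_suml; move: t_sum; rewrite (bigD1 i) //= => /eqP.
by rewrite addrC addr_eq0 => /eqP ->; rewrite mulNr divff // mulrNN mulr1.
Qed.

(** Two terms of an algebraic relation for [x] share the maximal valuation, so some
   power [x^e] with [0 < e <= n] is a power of [l] times a unit; the exponent [n!]
   serves all [x] at once. *)
Lemma ramification x : x != 0 ->
  exists k, valunit (x ^+ n`! / L ^ k).
Proof.
move=> x0; have [p [p0 sp /rootP px]] := algK x.
pose t (i : 'I_(size p)) := (p`_i)%:~R * x ^+ i.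
have cE (i : nat) : (p`_i)%:~R = 0 :> K -> p`_i = 0.
  move=> c0; apply: contra_eq c0 => /valunit_int[a [+ _ _]].
  by rewrite mulf_eq0 => /norP[].
have [|| i [j [ij ti tj u]]] := @valunit_relation _ t.
- have sz : (size (map_poly intr p : {poly K}) <= size p)%N by exact: size_poly.
  rewrite -[RHS]px (horner_coef_wide _ sz).
  by apply: eq_bigr => i _; rewrite coef_map.
- have sp0 : (0 < size p)%N by rewrite size_poly_gt0.
  have lt : ((size p).-1 < size p)%N by rewrite prednK.
  exists (Ordinal lt); rewrite mulf_neq0 ?expf_neq0 //=.
  by apply/eqP => /cE /eqP; rewrite -lead_coefE lead_coef_eq0 (negbTE p0).
wlog lt_ij : i j ij ti tj u / (i < j)%N.
  move=> WL; case: (ltngtP i j) => [lt|lt|e]; first exact: (WL i j).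
    apply: (WL j i) => //; first by rewrite eq_sym.
    by rewrite -invf_div; apply: valunitV.
  by rewrite (ord_inj e) eqxx in ij.
have nz (c : 'I_(size p)) : t c != 0 -> p`_c != 0.
  by apply: contraNneq => e; rewrite /t e mul0r.
have [a ua] := valunit_int (nz _ ti); have [c uc] := valunit_int (nz _ tj).
have L0 m : L ^+ m != 0 by rewrite expf_neq0.
have pi0 : (p`_i)%:~R != 0 :> K by apply: contraNneq ti => e; rewrite /t e mul0r.
have pj0 : (p`_j)%:~R != 0 :> K by apply: contraNneq tj => e; rewrite /t e mul0r.
have e : x ^+ (j - i) = (t j / t i) * (((p`_i)%:~R / L ^+ a) / ((p`_j)%:~R / L ^+ c)) * L ^ (a%:Z - c%:Z).
  rewrite expfB // expfzDr // -exprnN -exprnP /t; field.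
  by rewrite pi0 pj0 !expf_neq0.
have ji : (0 < j - i <= n)%N.
  rewrite subn_gt0 lt_ij /= (leq_trans (leq_subr _ _)) //.
  by rewrite -ltnS (leq_trans (ltn_ord j)).
have /dvdnP[q ->] := dvdn_fact ji.
exists ((a%:Z - c%:Z) * q); rewrite mulnC exprM e exprMn_comm; last exact: mulrC.
rewrite -exprz_exp -exprnP mulfK ?expf_neq0 ?expfz_neq0 //.
by apply: valunitX; do 2![apply: valunitM => //]; apply: valunitV.
Qed.

Definition ordl x : int := xget 0 [set k | valunit (x ^+ n`! / L ^ k)].

Lemma ordlP x : x != 0 -> valunit (x ^+ n`! / L ^ ordl x).
Proof. by move=> /ramification[k ?]; rewrite /ordl; case: xgetP => // /(_ k). Qed.

Lemma ordl_uniq x k : valunit (x ^+ n`! / L ^ k) -> ordl x = k.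
Proof.
move=> uk; have x0 : x != 0.
  apply/eqP => x0; case: uk => + _ _.
  by rewrite x0 expr0n gtn_eqF ?fact_gt0 // mul0r eqxx.
have := valunitM uk (valunitV (ordlP x0)).
have -> : x ^+ n`! / L ^ k * (x ^+ n`! / L ^ ordl x)^-1 = L ^ (ordl x - k).
  rewrite expfzDr // -invr_expz; field.
  by rewrite !expfz_neq0 // expf_neq0.
by move=> /valunit_Lz/eqP; rewrite subr_eq0 => /eqP.
Qed.

Lemma ordlM x y : x != 0 -> y != 0 -> ordl (x * y) = ordl x + ordl y.
Proof.
move=> x0 y0; apply: ordl_uniq.
have -> : (x * y) ^+ n`! / L ^ (ordl x + ordl y) =
    (x ^+ n`! / L ^ ordl x) * (y ^+ n`! / L ^ ordl y).
  by rewrite exprMn expfzDr //; field; rewrite !expfz_neq0.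
exact: valunitM (ordlP _) (ordlP _).
Qed.

Lemma ordlV x : x != 0 -> ordl x^-1 = - ordl x.
Proof.
move=> x0; apply: ordl_uniq; have := valunitV (ordlP x0).
by rewrite invf_div exprVn -invr_expz invrK mulrC.
Qed.

Lemma ordlX x m : x != 0 -> ordl (x ^+ m) = ordl x *+ m.
Proof.
move=> x0; elim: m => [|m IH].
  apply: ordl_uniq; rewrite expr0 expr1n divr1; split; rewrite ?oner_eq0 ?invr1 //.
by rewrite exprS ordlM ?expf_neq0 // IH mulrS.
Qed.

Lemma ordlXz x k : x != 0 -> ordl (x ^ k) = ordl x * k.
Proof.
move=> x0; case: k => m; first by rewrite -exprnP ordlX // pmulrn mulrzz.
by rewrite NegzE -exprnN ordlV ?expf_neq0 // ordlX // pmulrn mulrzz mulrN.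
Qed.

Lemma ordl_ge0 x : x != 0 -> B x <-> 0 <= ordl x.
Proof.
have pos y : y != 0 -> B y -> 0 <= ordl y.
  move=> y0 By; rewrite leNgt; apply/negP => lt0.
  have [m mE] : exists m, ordl y = Negz m by case: ordl lt0 => // m; exists m.
  have [_ _] := ordlP y0; rewrite mE NegzE -invr_expz invrK invfM -exprnP => Bi.
  apply: (lB (BM (BM (BX m BL) (BX n`! By)) Bi)).
  by rewrite -/L exprS; field; rewrite l0 !expf_neq0.
move=> x0; split; first exact: pos.
move=> ge0; have [//|Bi] := valB x.
have := pos _ _ Bi; rewrite invr_eq0 => /(_ x0); rewrite ordlV // oppr_ge0 => le0.
have [_ + _] := ordlP x0; have -> : ordl x = 0 by apply/eqP; rewrite eq_le le0.
rewrite expr0z divr1 => Bxn; have -> : x = x ^+ n`! * x^-1 ^+ (n`!).-1.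
  by rewrite -{1}(prednK (fact_gt0 n)) exprSr exprVn mulrAC mulfV ?mul1r // expf_neq0.
by apply: BM => //; apply: BX.
Qed.

Lemma ordl_unif : exists g : nat, [/\ (0 < g)%N,
  forall x, x != 0 -> (g%:Z %| ordl x)%Z & exists2 x, x != 0 & ordl x = g].
Proof.
pose P (g : nat) : bool := `[< (0 < g)%N /\ exists2 x, x != 0 & ordl x = g >].
have exP : exists g, P g.
  exists n`!; apply/asboolP; split; first exact: fact_gt0.
  exists L => //; apply: ordl_uniq; rewrite -exprnP divff ?expf_neq0 //.
  by split; rewrite ?oner_eq0 ?invr1.
case: (ex_minnP exP) => g /asboolP[g0 [p p0 pg]] gmin; exists g; split=> //; last by exists p.
move=> x x0; apply/dvdz_mod0P; apply/eqP; apply: contraTT isT => r0.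
have gz : g%:Z != 0 by rewrite eqz_nat -lt0n.
have rE : ordl (x * p ^ (- (ordl x %/ g)%Z)) = (ordl x %% g)%Z.
  rewrite ordlM ?expfz_neq0 // ordlXz // pg {1}(divz_eq (ordl x) g) mulrN [g%:Z * _]mulrC.
  by rewrite addrAC subrr add0r.
have [m mE] : exists m : nat, (ordl x %% g)%Z = m.
  by have := modz_ge0 (ordl x) gz; case: (modz _ _) => // m _; exists m.
have m_lt : (m < g)%N by rewrite -ltz_nat -mE ltz_pmod.
have /gmin : P m.
  apply/asboolP; split; first by rewrite lt0n -eqz_nat -mE.
  by exists (x * p ^ (- (ordl x %/ g)%Z)); rewrite ?rE ?mulf_neq0 ?expfz_neq0.
by rewrite leqNgt m_lt.
Qed.

(** The exponents [ordl x] form a nonzero subgroup of the integers; dividing by its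
   generator normalizes the valuation. *)
Lemma valuation_ring_discrete : exists w : absval R K,
  finite_place w /\ forall x, w x <= 1 <-> B x.
Proof.
have [g [g0 gdvd [p p0 pg]]] := ordl_unif.
have gz : 0 < g%:Z by rewrite ltz_nat.
pose v x := (ordl x %/ g)%Z.
have vE x : x != 0 -> ordl x = v x * g by move=> /gdvd/divzK ->.
have vI x k : x != 0 -> ordl x = k * g -> v x = k.
  by move=> x0 e; rewrite /v e mulzK // gt_eqF.
have vM x y : x != 0 -> y != 0 -> v (x * y) = v x + v y.
  by move=> x0 y0; apply: vI; rewrite ?mulf_neq0 // ordlM // !vE // mulrDl.
have v_ge0 x : x != 0 -> B x <-> 0 <= v x.
  by move=> x0; rewrite ordl_ge0 // vE // pmulr_lge0.
pose w x : R := if x == 0 then 0 else 2 ^ (- v x).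
have two0 (k : int) : 0 < 2 ^ k :> R by rewrite exprz_gt0.
have w_ge0 x : 0 <= w x by rewrite /w; case: eqP => // _; apply: ltW.
have w_eq0 x : (w x == 0) = (x == 0).
  by rewrite /w; case: (eqVneq x 0) => [_|x0]; rewrite ?eqxx // gt_eqF.
have wM x y : w (x * y) = w x * w y.
  rewrite /w mulf_eq0; case: (eqVneq x 0) => [_|x0] /=; first by rewrite mul0r.
  case: (eqVneq y 0) => [_|y0] /=; first by rewrite mulr0.
  by rewrite vM // opprD expfzDr.
have wU x y : w (x + y) <= Num.max (w x) (w y).
  have [->|x0] := eqVneq x 0; first by rewrite add0r le_max lexx orbT.
  have [->|y0] := eqVneq y 0; first by rewrite addr0 le_max lexx.
  have [s0|s0] := eqVneq (x + y) 0.
    by rewrite s0 /w eqxx le_max -/(w x) w_ge0.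
  wlog Byx : x y x0 y0 s0 / B (y / x).
    move=> WL; have [|] := valB (y / x); first exact: WL.
    rewrite invf_div addrC maxC => Bxy; apply: WL => //.
    by rewrite addrC.
  rewrite le_max /w (negbTE x0) (negbTE s0); apply/orP; left.
  rewrite ler_eXz2l ?ltr1n // lerN2.
  have xyE : x + y = x * (1 + y / x) by field.
  have u0 : 1 + y / x != 0.
    by apply: contraNneq s0 => e; rewrite xyE e mulr0.
  by rewrite xyE vM // lerDl -v_ge0 //; apply: subringD.
have wD x y : w (x + y) <= w x + w y.
  apply: (le_trans (wU x y)); rewrite ge_max.
  by rewrite lerDl w_ge0 lerDr w_ge0.
exists (AbsVal w_ge0 w_eq0 wM wD); split.
  split=> //= [x x0|]; first by exists (- v x); rewrite /w (negbTE x0).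
  exists p; rewrite /w (negbTE p0) (vI p 1) ?mul1r // exprN1 //.
move=> x /=; rewrite /w; have [->|x0] := eqVneq x 0.
  by split=> // _; exact: subring0.
rewrite v_ge0 // -[X in _ <= X](expr0z 2) ler_eXz2l ?ltr1n // oppr_le0.
by split.
Qed.

End DiscreteValuation.

(** * Minimal polynomials and the embeddings of the number field *)

Section SpectralMapping.

Lemma root_char_polyE (F : fieldType) n (A : 'M[F]_n.+1) r :
  root (char_poly A) r = (horner_mx A ('X - r%:P) \notin unitmx).
Proof.
rewrite -eigenvalue_root_char /eigenvalue /eigenspace kermx_eq0 row_free_unit.
by rewrite rmorphB /= horner_mx_X horner_mx_C.
Qed.

Lemma char_poly_horner_mx (F : fieldType) n (A : 'M[F]_n.+1) (g : {poly F}) z :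
  root (char_poly A) z -> root (char_poly (horner_mx A g)) g.[z].
Proof.
move=> Az; rewrite root_char_polyE rmorphB /= horner_mx_X horner_mx_C.
have /factor_theorem[q qE] : root (g - g.[z]%:P) z.
  by rewrite rootE !hornerE subrr.
rewrite -[_%:M](horner_mx_C A) -rmorphB qE rmorphM /= unitmx_mul negb_and.
by rewrite -root_char_polyE Az orbT.
Qed.

(** Spectral mapping over an algebraically closed field, by Cayley-Hamilton: if
   [g - r] has no common root with the characteristic polynomial of [A], a
   Bezout relation makes [g(A) - r] invertible. *)
Lemma root_char_poly_horner_mx (F : closedFieldType) n (A : 'M[F]_n.+1)
    (g : {poly F}) r :
  root (char_poly (horner_mx A g)) r -> exists2 z, root (char_poly A) z & g.[z] = r.
Proof.
rewrite root_char_polyE rmorphB /= horner_mx_X horner_mx_C => Ar.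
apply: contrapT => no; case/negP: Ar.
have /Bezout_eq1_coprimepP[[u v] /= uv] : coprimep (char_poly A) (g - r%:P).
  apply: Pdiv.ClosedField.root_coprimep => z Az; rewrite !hornerE subr_eq0.
  by apply/eqP => e; apply: no; exists z.
have := congr1 (horner_mx A) uv.
rewrite rmorphD !rmorphM /= Cayley_Hamilton mulr0 add0r rmorphB /= horner_mx_C rmorph1.
by move=> /mulmx1_unit[].
Qed.

Lemma companion_exists (F : fieldType) (p : {poly F}) n :
  p \is monic -> size p = n.+2 -> exists A : 'M[F]_n.+1, char_poly A = p.
Proof.
move=> mp sp; have : exists A : 'M[F]_((size p).-1), char_poly A = p.
  by exists (companionmx p); apply: companionmxK.
by rewrite sp.
Qed.

End SpectralMapping.

Section MinimalPolynomials.
Variable R : realType.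
Implicit Types (y : R) (g : {poly rat}).

(** Polynomials with a common root in some extension are not coprime. *)
Lemma irreducible_dvd (F : fieldType) (f : {rmorphism rat -> F}) (p g : {poly rat}) (z : F) :
  irreducible_poly p -> root (map_poly f p) z -> root (map_poly f g) z -> p %| g.
Proof.
move=> irr pz gz; apply: contraT; rewrite -irreducible_poly_coprime // => cop.
by move: cop; rewrite -(coprimep_map f) => /coprimep_root/(_ pz); rewrite (eqP gz) eqxx.
Qed.

Lemma map_intr_ratr (F : numFieldType) (p : {poly int}) :
  map_poly (ratr : rat -> F) (map_poly intr p) = map_poly intr p.
Proof. by rewrite -map_poly_comp; apply: eq_map_poly => c /=; rewrite ratr_int. Qed.

(** Gauss's lemma: the minimal polynomial over the rationals divides a monic
   integral polynomial, so it is integral itself. *)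
Lemma integral_minpoly y : integralOver (intr : int -> R) y ->
  exists P : {poly int}, [/\ P \is monic, irreducible_poly (map_poly intr P : {poly rat})
    & root (map_poly intr P) y].
Proof.
move=> [p pm py].
pose D (d : nat) : bool := `[< exists q : {poly rat},
  [/\ q \is monic, root (map_poly ratr q) y & size q = d] >].
have exD : exists d, D d.
  exists (size p); apply/asboolP; exists (map_poly intr p); split.
  - exact: monic_map.
  - by rewrite map_intr_ratr.
  - by rewrite size_map_inj_poly //; apply: intr_inj.
case: (ex_minnP exD) => d /asboolP[q [qm qy qd]] dmin.
have q_root g : root (map_poly ratr g) y -> g != 0 -> (size q <= size g)%N.
  move=> gy g0; rewrite qd; apply: dmin; apply/asboolP.
  have lg : lead_coef g != 0 by rewrite lead_coef_eq0.
  exists ((lead_coef g)^-1 *: g); split.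
  - by rewrite monicE lead_coefZ mulVf.
  - by rewrite map_polyZ rootE hornerZ (eqP gy) mulr0.
  - by rewrite size_scale ?invr_eq0.
have q0 : q != 0 by apply: monic_neq0.
have irr : irreducible_poly q.
  split.
    rewrite ltnNge; apply/negP => q1; move: qy; rewrite (size1_polyC q1) map_polyC.
    rewrite rootE hornerC fmorph_eq0 -polyC_eq0 -(size1_polyC q1).
    by rewrite (negbTE q0).
  move=> g g1 gq; rewrite -dvdp_size_eqp // eqn_leq dvdp_leq //=.
  have [h qE] := dvdpP _ _ gq.
  have [g0 h0] : g != 0 /\ h != 0.
    by split; apply: contraNneq q0 => e; rewrite qE e ?mulr0 ?mul0r.
  move: (qy); rewrite qE rmorphM rootM => /orP[hy|gy]; last by rewrite -qE q_root.
  move: (q_root _ hy h0); rewrite qE size_mul //.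
  have : (0 < size g)%N by rewrite size_poly_gt0.
  by case: (size g) g1 => [|[|k]] // _ _; rewrite addnS /= addnS ltnNge leq_addr.
have /dvdpP_rat_int[P1 [a a0 qE] [r pE]] : q %| map_poly intr p.
  by apply: (irreducible_dvd (f := ratr) irr qy); rewrite map_intr_ratr.
have lc : lead_coef P1 * lead_coef r = 1 by rewrite -lead_coefM -pE (monicP pm).
have [u P1u] : exists u : bool, lead_coef P1 = (-1) ^+ u.
  have : lead_coef P1 \is a GRing.unit by apply/unitrP; exists (lead_coef r); rewrite [_ * lead_coef P1]mulrC.
  by rewrite qualifE /= => /orP[] /eqP->; [exists false|exists true].
exists ((-1) ^+ u *: P1).
have qE' : map_poly intr ((-1) ^+ u *: P1) = q.
  have := monicP qm; rewrite qE lead_coefZ lead_coef_map_inj; [|exact: intr_inj|by []].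
  rewrite P1u map_polyZ /= => au; congr (_ *: _).
  have : (a * ((-1) ^+ u)%:~R) * ((-1) ^+ u)%:~R = ((-1) ^+ u)%:~R :> rat by rewrite au mul1r.
  by rewrite -mulrA -intrM -expr2 sqrr_sign mulr1 => ->.
split.
- by rewrite monicE lead_coefZ P1u -expr2 sqrr_sign.
- by rewrite qE'.
- by rewrite -map_intr_ratr qE'.
Qed.

End MinimalPolynomials.

Section NumberField.
Variables (R : realType) (b : R).
Hypothesis b_int : integralOver (intr : int -> R) b.

Local Notation K := (Qbeta b).
Local Notation C := R[i].

Definition Qvalm : {rmorphism K -> R} := val.

Lemma Qval_inj : injective (@Qval R b). Proof. exact: val_inj. Qed.

Lemma minpolyP : [/\ minpoly b \is monic, irreducible_poly (minpoly b)
  & root (map_poly ratr (minpoly b)) b].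
Proof.
have [P [Pm Pi Pb]] := integral_minpoly b_int.
rewrite /minpoly.
apply: (@xgetPex _ 0 [set q : {poly rat} | [/\ q \is monic, irreducible_poly q
  & root (map_poly ratr q) b]]); exists (map_poly intr P); split=> //.
  exact: monic_map.
by rewrite map_intr_ratr.
Qed.

Lemma minpoly_int : exists2 P : {poly int}, P \is monic & map_poly intr P = minpoly b.
Proof.
have [P [Pm Pi Pb]] := integral_minpoly b_int.
have [mm mi mb] := minpolyP; exists P => //.
have Pb' : root (map_poly ratr (map_poly intr P : {poly rat})) b by rewrite map_intr_ratr.
apply/eqP; rewrite -eqp_monic ?monic_map // /eqp.
by rewrite (irreducible_dvd Pi Pb' mb) (irreducible_dvd mi mb Pb').
Qed.

Lemma minpoly_size : exists n, size (minpoly b) = n.+2.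
Proof.
have [_ [s1 _] _] := minpolyP.
by exists (size (minpoly b)).-2; case: (size _) s1 => [|[]].
Qed.

Lemma conjugatesP (z : C) : (z \in conjugates b) = root (map_poly ratr (minpoly b)) z.
Proof.
rewrite /conjugates; case: closed_field_poly_normal => s /= ->.
have [mm _ _] := minpolyP.
by rewrite (monicP (monic_map _ mm)) scale1r root_prod_XsubC.
Qed.

Lemma root_minpoly_dvd g : root (map_poly ratr g) b -> minpoly b %| g.
Proof. by have [_ mi mb] := minpolyP; apply: (irreducible_dvd mi mb). Qed.

Lemma Qbeta_horner (x : K) : exists g : {poly rat}, Qval x = (map_poly ratr g).[b].
Proof.
pose S : {pred R} := [pred x | `[< exists g : {poly rat}, x = (map_poly ratr g).[b] >]].
have S_ring : divring_closed S.
  split.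
  - by apply/asboolP; exists 1; rewrite rmorph1 hornerC.
  - move=> _ _ /asboolP[g ->] /asboolP[h ->]; apply/asboolP; exists (g - h).
    by rewrite rmorphB !hornerE.
  - move=> _ _ /asboolP[g ->] /asboolP[h ->]; apply/asboolP.
    have [hb|hb] := boolP (root (map_poly ratr h) b).
      by exists 0; rewrite (eqP hb) invr0 mulr0 rmorph0 horner0.
    have [mm mi mb] := minpolyP.
    have /Bezout_eq1_coprimepP[[u v] /= uv] : coprimep (minpoly b) h.
      rewrite irreducible_poly_coprime //; apply: contra hb => /dvdpP[q ->].
      by rewrite rmorphM rootM mb orbT.
    exists (g * v); rewrite rmorphM hornerM; congr (_ * _).
    have := congr1 (fun p => (map_poly (ratr : rat -> R) p).[b]) uv.
    rewrite /= rmorphD !rmorphM rmorph1 !hornerE (eqP mb) mulr0 add0r => e.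
    by apply: (mulIf hb); rewrite mulVf.
have /asboolP/(_ S S_ring) := Qval_adj x.
case/(_ _)/asboolP => [|g gx]; last by exists g.
by apply/asboolP; exists 'X; rewrite map_polyX hornerX.
Qed.

Lemma horner_morph_rat (F : fieldType) (s : {rmorphism K -> F}) (g : {poly rat}) (x : K) :
  s (map_poly ratr g).[x] = (map_poly ratr g).[s x].
Proof.
rewrite -horner_map -map_poly_comp; congr (_.[_]); apply: eq_map_poly => c /=.
by rewrite fmorph_rat.
Qed.

Lemma embedding_horner (F : fieldType) (s : {rmorphism K -> F}) g x :
  Qval x = (map_poly ratr g).[b] -> s x = (map_poly ratr g).[s (beta b)].
Proof.
move=> xg; rewrite -horner_morph_rat; congr (s _); apply: Qval_inj.
by rewrite -[RHS]/(Qvalm _) horner_morph_rat xg.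
Qed.

(** Evaluating at [z] the polynomial expressions in [b] is well defined because the
   minimal polynomial divides every rational polynomial that vanishes at [b]. *)
Lemma embedding_exists (z : C) : z \in conjugates b ->
  exists s : {rmorphism K -> C}, s (beta b) = z.
Proof.
rewrite conjugatesP => mz.
pose gx (x : K) : {poly rat} := sval (cid (Qbeta_horner x)).
have gxE x : Qval x = (map_poly ratr (gx x)).[b] by rewrite /gx; case: cid.
pose s (x : K) : C := (map_poly ratr (gx x)).[z].
have sE x g : Qval x = (map_poly ratr g).[b] -> s x = (map_poly ratr g).[z].
  move=> gb; apply/eqP; rewrite -subr_eq0 -hornerN -hornerD -rmorphB -rootE.
  apply: root_dvdp mz; rewrite dvdp_map; apply: root_minpoly_dvd.
  by rewrite rmorphB rootE !hornerE -gxE gb subrr.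
have sB : zmod_morphism s.
  by move=> x y; rewrite (sE _ (gx x - gx y)) rmorphB !hornerE // -!gxE.
have sM : monoid_morphism s.
  split; first by rewrite (sE _ 1) rmorph1 hornerC.
  by move=> x y; rewrite (sE _ (gx x * gx y)) rmorphM !hornerE // -!gxE.
pose sm := HB.pack_for {rmorphism K -> C} s
  (GRing.isZmodMorphism.Build K C s sB) (GRing.isMonoidMorphism.Build K C s sM).
exists sm => /=; rewrite (sE _ 'X) map_polyX hornerX //.
Qed.

Lemma beta_conjugate (s : {rmorphism K -> C}) : s (beta b) \in conjugates b.
Proof.
have [mm mi mb] := minpolyP; rewrite conjugatesP rootE.
by rewrite -(embedding_horner s (x := 0)) ?rmorph0 // (eqP mb).
Qed.

(** If [x = g(b)] and [A] is the companion matrix of the minimal polynomial, then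
   [chi] is the characteristic polynomial of [g(A)]; the spectral mapping theorem
   identifies its complex roots with the conjugates of [x]. *)
Lemma field_polynomial (x : K) : exists chi : {poly rat},
  [/\ chi \is monic, size chi = size (minpoly b), root (map_poly ratr chi) (Qval x)
    & forall r : C, root (map_poly ratr chi) r ->
        exists s : {rmorphism K -> C}, s x = r].
Proof.
have [mm mi mb] := minpolyP; have [n mn] := minpoly_size.
have [A Am] := companion_exists mm mn; have [g gx] := Qbeta_horner x.
exists (char_poly (horner_mx A g)); split.
- exact: char_poly_monic.
- by rewrite size_char_poly mn.
- rewrite map_char_poly map_horner_mx gx; apply: char_poly_horner_mx.
  by rewrite -map_char_poly Am.
- move=> r; rewrite map_char_poly map_horner_mx => /root_char_poly_horner_mx[z].
  rewrite -map_char_poly Am -conjugatesP => /embedding_exists[s sz] gz.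
  by exists s; rewrite (embedding_horner s gx) sz.
Qed.

Lemma clear_denominators (p : {poly rat}) (F : numFieldType) :
  p != 0 -> exists q : {poly int}, [/\ q != 0, size q = size p &
    forall x : F, root (map_poly ratr p) x -> root (map_poly intr q) x].
Proof.
move=> p0; have [q [a a0 pE]] := rat_poly_scale p.
have q0 : q != 0 by apply: contraNneq p0 => e; rewrite pE e rmorph0 scaler0.
exists q; split=> //.
  by rewrite pE size_scale ?invr_eq0 ?intr_eq0 // size_map_inj_poly //; apply: intr_inj.
move=> x; rewrite pE map_polyZ rootE hornerZ mulf_eq0 fmorph_eq0.
by rewrite invr_eq0 intr_eq0 (negbTE a0) /= map_intr_ratr.
Qed.

End NumberField.

(** * Finiteness of algebraic integers of bounded height *)

Import ComplexField.Normc.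

Section EmbeddingPlaces.
Local Open Scope complex_scope.
Variables (R : realType) (K : fieldType) (s : {rmorphism K -> R[i]}).

Lemma normc_normr (z : R[i]) : `|z| = (normc z)%:C.
Proof. by case: z => x y; rewrite normc_def. Qed.

Let w (x : K) : R := normc (s x).

Let w_ge0 x : 0 <= w x.
Proof. by rewrite -lecR -normc_normr normr_ge0. Qed.

Let w_eq0 x : (w x == 0) = (x == 0).
Proof.
rewrite -(fmorph_eq0 s); apply/eqP/eqP => [|e]; first exact: eq0_normc.
by rewrite /w e normc0.
Qed.

Let wM x y : w (x * y) = w x * w y.
Proof. by rewrite /w rmorphM normcM. Qed.

Let wD x y : w (x + y) <= w x + w y.
Proof. by rewrite /w rmorphD le_normcD. Qed.

Definition embedding_absval := AbsVal w_ge0 w_eq0 wM wD.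

Lemma embedding_absval_infinite : infinite_place embedding_absval.
Proof. by exists s => x; rewrite normc_normr. Qed.

End EmbeddingPlaces.

Section BoundedPolynomials.

Lemma prod_XsubC_coef_bound (D : numDomainType) (M : D) (s : seq D) :
  0 <= M -> (forall r, r \in s -> `|r| <= M) ->
  forall i, `|(\prod_(r <- s) ('X - r%:P))`_i| <= (1 + M) ^+ size s.
Proof.
move=> M0; have M1 : 0 <= 1 + M by rewrite addr_ge0.
elim: s => [|r s IH] sM i.
  rewrite big_nil coef1 expr0; case: (i == 0)%N; rewrite ?normr0 ?normr1 //.
rewrite big_cons mulrBl coefB coefXM coefCM exprS mulrDl mul1r.
have {}IH j : `|(\prod_(r <- s) ('X - r%:P))`_j| <= (1 + M) ^+ size s.
  by apply: IH => t ts; apply: sM; rewrite inE ts orbT.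
apply: (le_trans (ler_normB _ _)); apply: lerD.
  by case: (i == 0)%N; rewrite ?normr0 ?exprn_ge0.
rewrite normrM; apply: ler_pM => //; apply: sM; exact: mem_head.
Qed.

Lemma finite_bounded_int_poly (N B : nat) :
  finite_set [set p : {poly int} | (size p <= N)%N /\ forall i, (absz (p`_i)%R <= B)%N].
Proof.
pose f (c : {ffun 'I_N -> 'I_(B + B).+1}) : {poly int} :=
  \poly_(i < N) (if insub i is Some j then (c j : nat)%:Z - B%:Z else 0).
apply: (@sub_finite_set _ _ (f @` setT)); last exact/finite_image/finite_finset.
move=> p [sp pB]; exists [ffun i : 'I_N => inord (absz (p`_i + B%:Z)%R)] => //.
apply/polyP => i; rewrite /f coef_poly.
case: ltnP => [iN|Ni]; last by rewrite nth_default // (leq_trans sp).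
rewrite insubT ffunE /= inordK; have := pB i; set c := p`_i; move: c => c; lia.
Qed.

Lemma finite_roots (F : closedFieldType) (p : {poly F}) :
  p != 0 -> finite_set [set x | root p x].
Proof.
move=> p0; have [s sE] := closed_field_poly_normal p.
apply: (@sub_finite_set _ _ [set` s]); last exact: finite_seq.
by move=> x /=; rewrite {1}sE rootZ ?lead_coef_eq0 // root_prod_XsubC.
Qed.

End BoundedPolynomials.

Section NumberFieldFiniteness.
Local Open Scope complex_scope.
Variables (R : realType) (b : R).
Hypothesis b_int : integralOver (intr : int -> R) b.

Local Notation K := (Qbeta b).
Local Notation C := R[i].

(** Northcott's argument: such an integer is a root of a monic integral polynomial
   of bounded degree, whose roots are values of [x] under embeddings, so that its
   coefficients are bounded too. *)
Lemma finite_bounded_integers (M : R) :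
  finite_set [set x : K | [/\ integralOver (intr : int -> R) (Qval x), `|Qval x| <= M
    & forall w : absval R K, infinite_place w -> ~ is_p1 w -> w x <= M]].
Proof.
pose N := size (minpoly b).
have [M0|M0] := ltP M 0.
  apply: (@sub_finite_set _ _ set0) => [x [_ xM _]|]; last exact: finite_set0.
  by move: (le_lt_trans xM M0); rewrite normr_lt0.
pose B := Num.bound ((1 + M) ^+ N).
have MB : (1 + M) ^+ N < B%:R by apply: archi_boundP; rewrite exprn_ge0 ?addr_ge0.
pose S := [set p : {poly int} | (size p <= N)%N /\ forall i, (absz (p`_i)%R <= B)%N].
have real_inj : {in setT &, injective (fun x : K => (Qval x)%:C)}.
  by move=> x y _ _ /= [] /Qval_inj.
apply: (@sub_finite_set _ _ (\bigcup_(p in S `\ 0)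
    ((fun x : K => (Qval x)%:C) @^-1` [set z : C | root (map_poly intr p) z]))); last first.
  apply: bigcup_finite => [|p [_ /eqP p0]].
    exact/finite_setD/finite_bounded_int_poly.
  apply: finite_preimage => [x y _ _|]; first exact: real_inj (in_setT _) (in_setT _).
  apply: finite_roots; rewrite map_poly_eq0_id0 ?intr_eq0 ?lead_coef_eq0 //.
move=> x [x_int xM xwM]; have [P [Pm Pi Px]] := integral_minpoly x_int.
have [chi [chim chis chix chiC]] := field_polynomial b_int x.
have Pchi : map_poly intr P %| chi.
  by apply: (irreducible_dvd (f := ratr) Pi (z := Qval x)); rewrite ?map_intr_ratr.
have sP : (size P <= N)%N.
  rewrite /N -chis -(size_map_inj_poly (f := intr : int -> rat)) //; last exact: intr_inj.
  by apply: dvdp_leq => //; apply: monic_neq0.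
exists P; last first.
  rewrite /=; have -> : map_poly intr P = map_poly (real_complex R) (map_poly intr P).
    by rewrite -map_poly_comp; apply: eq_map_poly => c /=; rewrite rmorph_int.
  by rewrite rootE horner_map (eqP Px) rmorph0.
split; last exact/eqP/monic_neq0; split=> // i.
have [s sE] := closed_field_poly_normal (map_poly intr P : {poly C}).
have PCm : (map_poly intr P : {poly C}) \is monic by apply: monic_map.
rewrite (monicP PCm) scale1r in sE.
have sM r : r \in s -> `|r| <= M%:C.
  rewrite -root_prod_XsubC -sE => Pr.
  have [|t <-] := chiC r.
    apply: (root_dvdp (p := map_poly ratr (map_poly intr P))); first by rewrite dvdp_map.
    by rewrite map_intr_ratr.
  rewrite normc_normr lecR; have [p1|np1] := pselect (is_p1 (embedding_absval t)).
    by have := p1 x => /= ->.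
  exact: (xwM (embedding_absval t) (embedding_absval_infinite t)).
have M0' : 0 <= M%:C by rewrite (lecR 0).
have := prod_XsubC_coef_bound M0' sM i.
rewrite -sE coef_map /= -intr_norm.
have -> : (1 + M%:C) ^+ size s = ((1 + M) ^+ size s)%:C by rewrite rmorphXn rmorphD rmorph1.
have -> : (`|P`_i|)%:~R = (`|P`_i|%:~R)%:C :> C by rewrite rmorph_int.
rewrite lecR => Pis; rewrite -(ler_nat R) ltW //.
have -> : ((absz P`_i)%:R : R) = `|P`_i|%:~R by rewrite natr_absz.
apply: (le_lt_trans Pis); apply: le_lt_trans MB; apply: ler_weXn2l; first by rewrite lerDl.
have := size_prod_XsubC s id; rewrite -sE size_map_inj_poly //; last exact: intr_inj.
by move=> sPs; rewrite -ltnS -sPs ltnW.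
Qed.

End NumberFieldFiniteness.

(** * The primes dividing the generator *)

Section AbsoluteValues.
Variables (R : realType) (K : fieldType) (w : absval R K).
Implicit Types x y : K.

Lemma absvX x n : w (x ^+ n) = w x ^+ n.
Proof. by elim: n => [|n IH]; rewrite ?absv1 // !exprS absvM IH. Qed.

Lemma absvV x : w x^-1 = (w x)^-1.
Proof.
have [->|x0] := eqVneq x 0; first by rewrite invr0 absv0 invr0.
have wx0 : w x != 0 by rewrite absv_eq0.
by apply: (mulfI wx0); rewrite -absvM !mulfV // absv1.
Qed.

Lemma absv_nat n : w n%:R <= n%:R.
Proof.
elim: n => [|n IH]; first by rewrite absv0.
rewrite -addn1 !natrD (le_trans (absvD _ _ _)) // lerD //.
by rewrite absv1.
Qed.

End AbsoluteValues.

Section Ultrametric.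
Variables (R : realType) (K : fieldType) (w : absval R K).
Hypothesis wU : forall x y, w (x + y) <= Num.max (w x) (w y).

Lemma ultra_subring : subring [set x | w x <= 1].
Proof.
split=> /=; first by rewrite absv1.
  move=> x y wx wy; apply: (le_trans (wU _ _)).
  by rewrite ge_max wx absvN.
by move=> x y wx wy; rewrite absvM mulr_ile1 // absv_ge0.
Qed.

Lemma ultra_int (m : int) : w m%:~R <= 1.
Proof. exact: (subring_int m ultra_subring). Qed.

Lemma ultra_coprime (m n : int) : coprimez m n -> w n%:~R < 1 -> w m%:~R = 1.
Proof.
move=> /coprimezP[[u v] /= uv] wn; apply/eqP; rewrite eq_le ultra_int /= leNgt.
apply/negP => wm; have := absv1 w; rewrite -[X in w X](_ : (u * m + v * n)%:~R = 1); last by rewrite uv.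
rewrite intrD => e; have := wU (u * m)%:~R (v * n)%:~R; rewrite e leNgt => /negP; apply.
have wu k x : w x < 1 -> w (k%:~R * x) < 1.
  move=> wx; rewrite absvM; apply: le_lt_trans wx.
  by rewrite ler_piMl ?absv_ge0 // ultra_int.
by rewrite gt_max !intrM !wu.
Qed.

End Ultrametric.

Section FinitePlaces.
Variables (R : realType) (b : R).
Hypothesis b_int : integralOver (intr : int -> R) b.
Hypothesis b_gt1 : 1 < b.

Local Notation K := (Qbeta b).
Local Notation C := R[i].
Let bt : K := beta b.

Definition fin_place (w : absval R K) := finite_place w /\ w (beta b) < 1.

Lemma Zbeta_subring : subring (Zbeta b).
Proof.
split.
- by exists 1; rewrite rmorph1 hornerC.
- by move=> _ _ [p ->] [q ->]; exists (p - q); rewrite rmorphB !hornerE.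
- by move=> _ _ [p ->] [q ->]; exists (p * q); rewrite rmorphM hornerM.
Qed.

Lemma Zbeta_beta : Zbeta b bt.
Proof. by exists 'X; rewrite map_polyX hornerX. Qed.

Lemma beta_neq0 : bt != 0.
Proof.
apply/eqP => /(congr1 (@Qval R b)) bt0; have b0 : b = 0 := bt0.
by move: b_gt1; rewrite b0 ltr10.
Qed.

Lemma Qval0 : Qval (0 : K) = 0. Proof. exact: (rmorph0 (Qvalm b)). Qed.

Lemma QvalD (x y : K) : Qval (x + y) = Qval x + Qval y.
Proof. exact: (rmorphD (Qvalm b)). Qed.

Lemma QvalN (x : K) : Qval (- x) = - Qval x.
Proof. exact: (rmorphN (Qvalm b)). Qed.

Lemma QvalM (x y : K) : Qval (x * y) = Qval x * Qval y.
Proof. exact: (rmorphM (Qvalm b)). Qed.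

Lemma QvalX (x : K) n : Qval (x ^+ n) = Qval x ^+ n.
Proof. exact: (rmorphXn (Qvalm b)). Qed.

Lemma QvalV (x : K) : Qval x^-1 = (Qval x)^-1.
Proof. exact: (fmorphV (Qvalm b)). Qed.

Lemma Qval_sum n (F : 'I_n -> K) : Qval (\sum_i F i) = \sum_i Qval (F i).
Proof. exact: (rmorph_sum (Qvalm b)). Qed.

Lemma Qval_int (m : int) : Qval (m%:~R : K) = m%:~R.
Proof. by rewrite -[LHS]/(Qvalm b _) rmorph_int. Qed.

Lemma Qval_rat (x : rat) : Qval (ratr x : K) = ratr x.
Proof. by rewrite -[LHS]/(Qvalm b _) fmorph_rat. Qed.

Lemma intr_Qbeta_eq0 (m : int) : (m%:~R == 0 :> K) = (m == 0).
Proof.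
apply/eqP/eqP => [/(congr1 (@Qval R b))|->] //.
by rewrite Qval_int => /eqP; rewrite -[Qval 0]/(0 : R) intr_eq0 => /eqP.
Qed.

Lemma Qval_horner_int (p : {poly int}) (x : K) :
  Qval (map_poly intr p).[x] = (map_poly intr p).[Qval x].
Proof.
rewrite -[LHS]/(Qvalm b _) -horner_map -map_poly_comp; congr (_.[_]).
by apply: eq_map_poly => c /=; rewrite Qval_int.
Qed.

Lemma Zbeta_integral x : Zbeta b x -> integralOver (intr : int -> R) (Qval x).
Proof.
move=> [p ->]; rewrite Qval_horner_int; apply: integral_horner => //.
by apply/integral_poly => i; rewrite coef_map; apply: integral_id.
Qed.

(** Up to sign the norm is the constant coefficient of the minimal polynomial,
   which gives both its divisibility by [beta] and the last property. *)
Lemma norm_int : exists N : int,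
  [/\ N%:~R = alg_norm b, N != 0, exists2 x, Zbeta b x & N%:~R = bt * x &
    forall p : {poly int}, (map_poly intr p).[bt] = 0 -> (N %| p`_0)%Z].
Proof.
have [P Pm PE] := minpoly_int b_int; have [mm mi mb] := minpolyP b_int.
have Pb : (map_poly intr P).[b] = 0 by rewrite -map_intr_ratr PE (eqP mb).
have Pdvd (p : {poly int}) : (map_poly intr p).[bt] = 0 -> exists r, p = P * r.
  move=> pb; have : minpoly b %| map_poly intr p.
    apply: root_minpoly_dvd => //.
    by rewrite rootE map_intr_ratr -(Qval_horner_int p bt) pb.
  by rewrite -PE dvdp_rat_int => /dvdpP_int[r ->]; exists r; rewrite zprimitive_monic.
have Pbt : (map_poly intr P).[bt] = 0 by apply: Qval_inj; rewrite Qval_horner_int Pb.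
exists ((-1) ^+ size (conjugates b) * P`_0); split.
- have : map_poly intr P = \prod_(z <- conjugates b) ('X - z%:P) :> {poly C}.
    rewrite /conjugates; case: closed_field_poly_normal => s /= e.
    rewrite -map_intr_ratr PE e (monicP (monic_map _ mm)) scale1r.
    by [].
  move=> /(congr1 (fun p : {poly C} => p`_0)); rewrite coef_map /= => e.
  rewrite rmorphM rmorphXn rmorphN1 /= e -horner_coef0 horner_prod.
  rewrite (eq_bigr (fun z => - z)) => [|z _]; last by rewrite !hornerE ?sub0r ?add0r.
  have prodN (s : seq C) : \prod_(z <- s) - z = (-1) ^+ size s * \prod_(z <- s) z.
    elim: s => [|a s IH]; rewrite ?big_nil ?mul1r // !big_cons IH exprS; ring.
  by rewrite prodN mulrA -expr2 sqrr_sign mul1r.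
- rewrite mulf_neq0 ?signr_eq0 //; apply/eqP => P0.
  have /factor_theorem[q qE] : root P 0 by rewrite rootE horner_coef0 P0.
  have [r rE] : exists r, q = P * r.
    apply: Pdvd; apply: (mulIf beta_neq0); rewrite mul0r -[RHS]Pbt qE.
    by rewrite rmorphM rmorphB /= map_polyX map_polyC hornerM !hornerE subr0.
  rewrite {1}rE in qE.
  have : P * (r * ('X - 0%:P)) = P * 1 by rewrite mulrA -qE mulr1.
  move=> /(mulfI (monic_neq0 Pm)) /(congr1 (fun p : {poly int} => p.[0])).
  by rewrite hornerM hornerXsubC subrr mulr0 hornerC.
- have /factor_theorem[q qE] : root (P - (P`_0)%:P) 0.
    by rewrite rootE !hornerE horner_coef0 subrr.
  have PE' : P = q * 'X + (P`_0)%:P by rewrite -[P in LHS](subrK (P`_0)%:P) qE polyC0 subr0.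
  move: (_ ^+ _ : int) => c.
  exists (map_poly intr (- c *: q)).[bt]; first by eexists.
  have e : (P`_0)%:~R = - (bt * (map_poly intr q).[bt]).
    apply/eqP; rewrite -addr_eq0 -Pbt {2}PE'.
    by rewrite rmorphD rmorphM /= map_polyX map_polyC !hornerE addrC mulrC.
  rewrite intrM e map_polyZ hornerZ rmorphN /=.
  by rewrite mulNr !mulrN mulrCA.
- move=> p /Pdvd[r ->]; rewrite -!horner_coef0 hornerM; apply/dvdzP.
  exists ((-1) ^+ size (conjugates b) * r.[0]).
  by rewrite mulrACA -expr2 sqrr_sign mul1r mulrC.
Qed.

Lemma fin_place_Zbeta w x : fin_place w -> Zbeta b x -> w x <= 1.
Proof.
move=> [[wU _ _] wb] [p ->]; have sw := ultra_subring wU.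
rewrite horner_coef; apply: (subring_sum sw) => i _; case: (sw) => _ _; apply.
  by rewrite coef_map; apply: ultra_int.
by apply: (subringX _ sw); apply: ltW.
Qed.

Lemma fin_place_beta_half w : fin_place w -> w bt <= 2^-1.
Proof.
move=> [[_ wZ _] wb]; have [k wk] := wZ _ beta_neq0.
move: wb; rewrite wk -(expr0z 2) -exprN1 ltr_eXz2l ?ltr1n // ler_eXz2l ?ltr1n //.
Qed.

Lemma fin_place_norm w (N : int) : fin_place w -> N%:~R = alg_norm b ->
  w N%:~R <= 2^-1.
Proof.
move=> fw NE; have [N' [N'E _ [x Zx N'x] _]] := norm_int.
have -> : N = N' by apply/eqP; rewrite -(eqr_int C) NE N'E.
rewrite N'x absvM; apply: le_trans (fin_place_beta_half fw).
by rewrite ler_piMr ?absv_ge0 // fin_place_Zbeta.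
Qed.

Lemma number_field_valuation (B : set K) (l : nat) : subring B ->
  (forall x, B x \/ B x^-1) -> prime l -> (forall x, B x -> l%:R * x <> 1) ->
  exists w : absval R K, [/\ finite_place w, forall x, w x <= 1 <-> B x &
    forall x, x != 0 -> (forall y, B y -> x * y <> 1) -> w x < 1].
Proof.
move=> sB valB l_prime lB.
have [n mn] := minpoly_size b_int.
have l0 : l%:R != 0 :> K.
  by rewrite -[_%:R]/(l%:Z%:~R : K) intr_Qbeta_eq0 eqz_nat -lt0n prime_gt0.
have algK (x : K) : exists p : {poly int},
    [/\ p != 0, (size p <= n.+2)%N & root (map_poly intr p) x].
  have [chi [chim chis chix _]] := field_polynomial b_int x.
  have [q [q0 qs qx]] := clear_denominators R (monic_neq0 chim).
  exists q; split=> //; first by rewrite qs chis mn.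
  by apply/eqP/Qval_inj; rewrite Qval_horner_int (eqP (qx _ chix)).
have [w [fw wB]] := @valuation_ring_discrete R _ _ _ _ sB valB l_prime l0 lB algK.
exists w; split=> // x x0 xB; rewrite ltNge; apply/negP => wx.
apply: (xB x^-1); last by rewrite mulfV.
by apply/wB; rewrite absvV invf_le1 // (lt_le_trans ltr01).
Qed.

Lemma prime_nonunit (B : set K) (n : nat) : subring B -> (0 < n)%N ->
  (forall x, B x -> n%:R * x <> 1) ->
  exists2 l, prime l & (l %| n)%N /\ forall x, B x -> l%:R * x <> 1.
Proof.
move=> sB; have [m] := ubnP n; elim: m n => // m IH n nm n0 nB.
have [n_le1|n1] := leqP n 1.
  case: (nB 1); first by case: sB.
  by rewrite (_ : n = 1%N) ?mulr1 //; apply/eqP; rewrite eqn_leq n_le1.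
have [lB|] := pselect (forall x, B x -> (pdiv n)%:R * x <> 1).
  by exists (pdiv n); [exact: pdiv_prime|split=> //; exact: pdiv_dvd].
rewrite -existsNP => -[x /not_implyP[Bx /contrapT lx]].
have nE := divnK (pdiv_dvd n).
case: (IH (n %/ pdiv n)%N) => [|||l pl [ld lB]].
- rewrite ltnS in nm; apply: leq_trans nm.
  by rewrite ltn_Pdiv // prime_gt1 // pdiv_prime.
- by rewrite divn_gt0 ?pdiv_gt0 // dvdn_leq // pdiv_dvd.
- move=> y By yn; apply: (nB (x * y)); first by case: sB => _ _; apply.
  have -> : n%:R = (pdiv n)%:R * (n %/ pdiv n)%:R :> K by rewrite -natrM mulnC nE.
  by rewrite mulrACA lx yn mulr1.
- exists l => //; split=> //; apply: dvdn_trans ld _.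
  by rewrite -[X in (_ %| X)%N]nE dvdn_mulr.
Qed.

(** If [y] were not integral, some valuation ring would contain [Z[beta]] and omit
   [y], hence omit [1/beta] as well; it would come from a prime dividing [beta] at
   which [y] is not integral. *)
Lemma integral_of_fin_places (y : K) (i : nat) : Zbeta b (bt ^+ i * y) ->
  (forall w, fin_place w -> w y <= 1) -> integralOver (intr : int -> R) (Qval y).
Proof.
move=> Zy wy; apply: contrapT => y_nint.
have y0 : y != 0.
  apply/eqP => y0; apply: y_nint; rewrite y0.
  by apply: Zbeta_integral; apply: subring0 Zbeta_subring.
have sA := adjoin_subring y^-1 Zbeta_subring.
have [||| B [sB AB B1 valB]] := @chevalley _ (adjoin (Zbeta b) y^-1) y^-1 0 sA.
- exact: adjoin_gen Zbeta_subring.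
- exact: subring0.
- move=> [u [v [[p [Zp ->]] _]]]; rewrite mul0r addr0 => e; apply: y_nint.
  pose r : {poly R} := \poly_(j < size p) Qval (p`_(size p - j.+1)).
  pose q : {poly R} := 'X^(size p) - r.
  have sq : (size r < (size p).+1)%N.
    by rewrite ltnS size_poly.
  apply: (@integral_root_monic _ _ _ _ q).
  + by rewrite monicE lead_coefDl ?size_polyXn ?size_polyN // lead_coefXn.
  + rewrite rootE hornerD hornerN hornerXn horner_poly subr_eq0.
    have E : y ^+ size p = \sum_(j < size p) p`_(size p - j.+1) * y ^+ j.
      rewrite -[LHS]mulr1 [X in _ * X]e horner_coef mulrCA !mulr_sumr.
      rewrite [RHS](reindex_inj rev_ord_inj) /=; apply: eq_bigr => j _.
      rewrite subnSK // subKn; last exact: ltnW.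
      rewrite (expfB_cond (m := size p)) ?(negbTE y0) ?add0n // exprS exprVn; field.
      by rewrite y0 expf_neq0.
    rewrite -QvalX E Qval_sum; apply/eqP/eq_bigr => j _.
    by rewrite QvalM QvalX.
  + apply/integral_poly => j; rewrite coefB coefXn; apply: integral_sub.
      exact: integral_nat.
    rewrite coef_poly; case: ifP => _; last exact: (integral_nat _ 0).
    exact: Zbeta_integral.
have Bnot x : B x -> y^-1 * x <> 1.
  move=> Bx e; apply: B1; exists x, 0; split=> //; first exact: subring0.
  by rewrite mulr0 addr0.
have ZB x : Zbeta b x -> B x by move=> Zx; apply: AB; apply: adjoin_sub Zx; apply: Zbeta_subring.
have bB x : B x -> bt * x <> 1.
  move=> Bx e; apply: (Bnot y); last by rewrite mulVf.
  have -> : y = (bt ^+ i * y) * x ^+ i by rewrite mulrAC -exprMn e expr1n mul1r.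
  by case: (sB) => _ _; apply; [exact: ZB|exact: subringX].
have [N [NE N0 [c Zc Nc] _]] := norm_int.
have NB x : B x -> (absz N)%:R * x <> 1.
  move=> Bx e; case: (bB (c * ((-1) ^+ (N < 0)%R * x))).
    case: (sB) => _ _ BM; apply: (BM); first exact: ZB.
    by apply: BM => //; rewrite -intr_sign; apply: subring_int.
  rewrite mulrA -Nc -[RHS]e mulrA; congr (_ * _).
  by rewrite {1}[N]intEsign rmorphM rmorph_sign /= mulrAC -expr2 sqrr_sign mul1r.
have [|l pl [_ lB]] := prime_nonunit sB _ NB; first by rewrite absz_gt0.
have [w [fw wB wlt]] := number_field_valuation sB valB pl lB.
apply: (Bnot y); last by rewrite mulVf.
by apply/wB; apply: wy; split=> //; apply: wlt => //; apply: beta_neq0.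
Qed.

(** The ring [Z[beta]/(l, beta)] is [Z/(l, N)], which is not zero; so [l] and [beta]
   lie in the maximal ideal of some valuation ring containing [Z[beta]]. *)
Lemma prime_norm_fin_place (N : int) (l : nat) : N%:~R = alg_norm b ->
  prime l -> (l %| N)%Z -> exists2 w, fin_place w & w l%:R < 1.
Proof.
move=> NE l_prime lN; have [N' [N'E _ _ N'P]] := norm_int.
have {}N'E : N' = N by apply/eqP; rewrite -(eqr_int C) NE N'E.
have Zl : Zbeta b l%:R by apply: (subring_int l Zbeta_subring).
have [|B [sB ZB B1 valB]] := @chevalley _ (Zbeta b) l%:R bt Zbeta_subring Zl Zbeta_beta.
  move=> [_ [_ [[p ->] [q ->] e]]].
  have G0 : (map_poly intr (1 - (l : int)%:P * p - 'X * q)).[bt] = 0 :> K.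
    rewrite !rmorphB !rmorphM rmorph1 /= map_polyC map_polyX !hornerE.
    by apply/eqP; rewrite -addrA -opprD subr_eq0; apply/eqP; exact: e.
  have := N'P _ G0; rewrite N'E -horner_coef0 !hornerE => Nd.
  have l1 : (l %| (1 : int))%Z.
    have := dvdz_trans lN Nd; rewrite ?mul0r ?subr0 => ld.
    by rewrite -[1](subrK (l%:Z * p.[0])) rpredD // dvdz_mulr.
  by move: l1; rewrite dvdz1 /= => /eqP l1; rewrite l1 in l_prime.
have lB x : B x -> l%:R * x <> 1.
  move=> Bx e; apply: B1; exists x, 0; split=> //; first exact: subring0.
  by rewrite mulr0 addr0.
have bB x : B x -> bt * x <> 1.
  move=> Bx e; apply: B1; exists 0, x; split=> //; first exact: subring0.
  by rewrite mulr0 add0r.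
have [w [fw wB wlt]] := number_field_valuation sB valB l_prime lB.
exists w; first by split=> //; apply: wlt => //; apply: beta_neq0.
apply: wlt => //; rewrite -[_%:R]/(l%:Z%:~R : K) intr_Qbeta_eq0 eqz_nat.
by rewrite -lt0n prime_gt0.
Qed.

End FinitePlaces.

(** * Branches of the iterated transformation *)

Section BetaTransformation.
Variables (R : realType) (b : R).
Hypothesis b_gt1 : 1 < b.
Implicit Types (x y t u v : R) (k : nat).

Local Notation T := (T b).
Local Notation Vhat := (Vhat b).

Let b_gt0 : 0 < b. Proof. exact: lt_trans b_gt1. Qed.
Let b_neq0 : b != 0. Proof. by rewrite gt_eqF. Qed.
Let bk_gt0 k : 0 < b ^+ k. Proof. exact: exprn_gt0. Qed.

Lemma T_itv x : 0 <= T x < 1.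
Proof.
rewrite /Defs.T subr_ge0 floor_le /= ltrBlDr -[1]/(1%:~R).
by rewrite -intrD addrC floorD1_gt.
Qed.

Lemma iter_T_itv k x : 0 <= x < 1 -> 0 <= iter k T x < 1.
Proof. by case: k => [//|k] _; rewrite iterS; apply: T_itv. Qed.

Lemma T_eq (d : int) x : 0 <= b * x - d%:~R < 1 -> T x = b * x - d%:~R.
Proof.
move=> /andP[ge0 lt1]; rewrite /Defs.T (_ : Num.floor (b * x) = d) //.
apply: floor_def; rewrite intrD; apply/andP; split; first by rewrite -subr_ge0.
by rewrite -ltrBlDl.
Qed.

Lemma T_div x : 0 <= x < 1 -> T (x / b) = x.
Proof. by move=> x01; rewrite (@T_eq 0) ?subr0 mulrC divfK. Qed.

(** The left limit of [T] at a positive point. *)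
Definition Tleft x : R := b * x - (Num.ceil (b * x) - 1)%:~R.

Lemma Tleft_eq (d : int) x : 0 < b * x - d%:~R <= 1 -> Tleft x = b * x - d%:~R.
Proof.
move=> /andP[gt0 le1]; rewrite /Tleft (_ : Num.ceil (b * x) = d + 1) ?addrK //.
apply: ceil_def; rewrite addrK intrD; apply/andP; split; first by rewrite -subr_gt0.
by rewrite -lerBlDl.
Qed.

Lemma Tleft_itv x : 0 < Tleft x <= 1.
Proof.
rewrite /Tleft subr_gt0 ceilB1_lt /= intrB; have := ceil_ge (b * x); lra.
Qed.

Lemma iter_Tleft_itv k : 0 < iter k Tleft 1 <= 1.
Proof. by case: k => [|k]; rewrite ?ltr01 ?lexx // iterS; apply: Tleft_itv. Qed.

Lemma iter_T_near1 k :
  \forall x \near 1^'-, iter k T x = iter k Tleft 1 - b ^+ k * (1 - x).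
Proof.
elim: k => [|k IH]; first by near=> x => /=; rewrite expr0; ring.
have e01 := iter_Tleft_itv k; set e := iter k Tleft 1 in IH e01 *.
have := Tleft_itv e; set d := (Num.ceil (b * e) - 1) => e'.
have e'E : Tleft e = b * e - d%:~R by [].
have c0 : 0 < Tleft e / b ^+ k.+1 by rewrite divr_gt0 //; case/andP: e'.
near=> x; rewrite iterS (near IH) // iterS -/e.
have x1 : x < 1 by [].
have xc : 1 - x < Tleft e / b ^+ k.+1.
  rewrite ltrBlDr -ltrBlDl; near: x; apply: nbhs_left_gt.
  by rewrite ltrBlDl ltrDr.
have xe : b ^+ k.+1 * (1 - x) < Tleft e by rewrite mulrC -ltr_pdivlMr.
have x0 : 0 < b ^+ k.+1 * (1 - x) by rewrite mulr_gt0 // subr_gt0.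
have bE : b * (e - b ^+ k * (1 - x)) - d%:~R = Tleft e - b ^+ k.+1 * (1 - x).
  by rewrite e'E exprS; ring.
rewrite (@T_eq d) bE //; apply/andP; split; first by rewrite subr_ge0 ltW.
by move: e' => /andP[_ ?]; lra.
Unshelve. all: by end_near.
Qed.

Lemma T1minusE k : T1minus b k = iter k Tleft 1.
Proof.
rewrite /T1minus; apply: cvg_lim; first exact: Rhausdorff.
have near_eq := iter_T_near1 k.
suff : iter k Tleft 1 - b ^+ k * (1 - x) @[x --> 1^'-] --> iter k Tleft 1.
  apply: cvg_trans; apply: near_eq_cvg.
  by near=> x; rewrite (near near_eq).
have -> : nbhs (iter k Tleft 1) = nbhs (iter k Tleft 1 - b ^+ k * (1 - 1)).
  by rewrite subrr mulr0 subr0.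
apply: cvg_at_left_filter; apply: cvgB; first exact: cvg_cst.
by apply: cvgM; [exact: cvg_cst|apply: cvgB; [exact: cvg_cst|exact: cvg_id]].
Unshelve. all: by end_near.
Qed.

Lemma Vhat1 : Vhat 1.
Proof. by exists 0%N => //; rewrite T1minusE. Qed.

Lemma Vhat_itv x : Vhat x -> 0 < x <= 1.
Proof. by move=> [k _ <-]; rewrite T1minusE iter_Tleft_itv. Qed.

Lemma hat_le v e : Vhat e -> v < e -> hat b v <= e.
Proof.
move=> Ve ve; apply: ge_inf; last by [].
by exists 0 => y [/Vhat_itv/andP[/ltW]].
Qed.

(** On a branch of the iterate of order [k] the values fill an interval from 0 to
   [e].  The next iterate cuts it into full branches and possibly a last one, which
   ends at [Tleft e]; so the ends stay in [Vhat]. *)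
Lemma branch k w : 0 <= w < 1 -> exists e, [/\ Vhat e, iter k T w < e &
  forall t, 0 <= t < e -> Tpre b k t (w + (t - iter k T w) / b ^+ k)].
Proof.
move=> w01; elim: k => [|k [e [Ve se lift]]].
  exists 1; split; [exact: Vhat1|by case/andP: w01|].
  move=> t t01 /=; rewrite /Tpre /= expr0 divr1 addrCA subrr addr0.
  by split.
have := iter_T_itv k w01; set s := iter k T w in se lift * => /andP[s0 s1].
have := T_itv s; rewrite iterS -/s {1 2}/Defs.T; set d := Num.floor (b * s).
have -> : T s = b * s - d%:~R by [].
move=> /andP[Ts0 Ts1].
have step e' : Vhat e' -> b * s - d%:~R < e' -> e' <= 1 -> e' + d%:~R <= b * e ->
    exists e, [/\ Vhat e, b * s - d%:~R < e &
    forall t, 0 <= t < e -> Tpre b k.+1 t (w + (t - (b * s - d%:~R)) / b ^+ k.+1)].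
  move=> Ve' lt_e' e'1 e'e; exists e'; split=> // t /andP[t0 te'].
  have d0 : 0 <= (d%:~R : R).
    by rewrite ler0z floor_ge0 mulr_ge0 // ltW.
  have [|w'01 w'k] := lift ((t + d%:~R) / b).
    rewrite divr_ge0 ?addr_ge0 ?(ltW b_gt0) //= ltr_pdivrMr // [e * b]mulrC.
    by apply: lt_le_trans e'e; rewrite ltrD2r.
  have wE : w + (t - (b * s - d%:~R)) / b ^+ k.+1 = w + ((t + d%:~R) / b - s) / b ^+ k.
    by rewrite exprS; field; rewrite b_neq0 gt_eqF.
  rewrite wE; split=> //; rewrite iterS w'k (@T_eq d) mulrC divfK // addrK //.
  by rewrite t0 (lt_le_trans te').
have [be|/ltW be] := lerP (b * e) (d%:~R + 1).
  have TE : Tleft e = b * e - d%:~R.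
    apply: Tleft_eq; rewrite subr_gt0 lerBlDl be andbT.
    by apply: le_lt_trans (_ : b * s < _); rewrite ?ltr_pM2l // -subr_ge0.
  apply: (step (Tleft e)).
  - by case: Ve => j _ <-; exists j.+1 => //; rewrite !T1minusE.
  - by rewrite TE ltrD2r ltr_pM2l.
  - by case/andP: (Tleft_itv e).
  - by rewrite TE subrK.
apply: (step 1) => //; first exact: Vhat1.
by rewrite addrC.
Qed.

(** No point of [Vhat] lies between [v] and [x], so [T^-k] of both points meets the
   same branches of the [k]-th iterate, all of slope [b^k]. *)
Lemma Tpre_shift k v x u : 0 <= v -> v <= x -> x < hat b v ->
  Tpre b k v u <-> Tpre b k x (u + (x - v) / b ^+ k).
Proof.
move=> v0 vx xv; split=> [[u01 uk]|[u01 uk]].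
  have [e [Ve ve lift]] := branch k u01; rewrite uk in ve lift.
  apply: lift; rewrite (le_trans v0) //=.
  exact: lt_le_trans (hat_le Ve ve).
have [e [Ve ve lift]] := branch k u01; rewrite uk in ve lift.
have -> : u = (u + (x - v) / b ^+ k) + (v - x) / b ^+ k.
  by rewrite -addrA -mulrDl addrA subrK subrr mul0r addr0.
by apply: lift; rewrite v0 (le_lt_trans vx).
Qed.

End BetaTransformation.

(** * The sets of scaled preimages in the number field *)

Section Preliminaries.

Lemma finite_max (R : realDomainType) (A : set R) : finite_set A -> A !=set0 ->
  exists2 m, A m & forall y, A y -> y <= m.
Proof.
move=> /finite_seqP[s ->] [x0 /= x0s].
elim: s x0 x0s => // a s IH x0 _; case: s IH => [_|c s IH].
  by exists a => [|y]; rewrite /= ?mem_head // mem_seq1 => /eqP->.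
have [|m ms mmax] := IH c; first exact: mem_head.
exists (Num.max a m) => [|y /=].
  rewrite /= maxEle; case: ifP => _; last exact: mem_head.
  by rewrite inE; apply/orP; right.
by rewrite inE le_max => /orP[/eqP->|/mmax->]; rewrite ?lexx ?orbT.
Qed.

Lemma finite_min (R : realDomainType) (A : set R) : finite_set A -> A !=set0 ->
  exists2 m, A m & forall y, A y -> m <= y.
Proof.
move=> Afin [x Ax]; have [||_ [m Am <-] mmax] := @finite_max R (-%R @` A).
- exact: finite_image.
- by exists (- x), x.
- by exists m => // y Ay; rewrite -lerN2; apply: mmax; exists y.
Qed.

(** Pigeonhole for filters: the substitute for passing to a subsequence. *)
Lemma filter_finite_split (T : Type) (I : eqType) (D : set I) (A : I -> set T)
    (G : set_system T) : ProperFilter G -> finite_set D ->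
  G (\bigcup_(i in D) A i) -> exists2 i, D i & ProperFilter (within (A i) G).
Proof.
move=> PG /finite_seqP[s ->] GU; apply: contrapT => no.
have GN i : i \in s -> G (~` A i).
  move=> si; apply: contrapT => nG; apply: no; exists i => //.
  split; last exact: within_filter.
  by move=> G0; apply: nG; apply: filterS G0 => x.
have : G (~` \bigcup_(i in [set` s]) A i).
  elim: s GN {GU no} => [|a s IH] GN.
    by apply: filterE => x [j].
  have Ga := GN a (mem_head _ _).
  have Gs : G (~` \bigcup_(i in [set` s]) A i).
    by apply: IH => i si; apply: GN; rewrite inE si orbT.
  apply: filterS2 Ga Gs => x xa xs [i /=].
  by rewrite inE => /orP[/eqP->//|si Ai]; apply: xs; exists i.
move=> GC; apply: (filter_not_empty G).
by apply: filterS2 GU GC => x.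
Qed.

End Preliminaries.

Section BetaAdic.
Local Open Scope complex_scope.
Variables (R : realType) (b : R).
Hypothesis hb : pisot b.

Local Notation K := (Qbeta b).
Local Notation C := R[i].
Let bt : K := beta b.

Let b_gt1 : 1 < b. Proof. by case: hb. Qed.
Let b_int : integralOver (intr : int -> R) b. Proof. by case: hb. Qed.
Let b_gt0 : 0 < b. Proof. exact: lt_trans b_gt1. Qed.
Let b_neq0 : b != 0. Proof. by rewrite gt_eqF. Qed.
Let bt_neq0 : bt != 0. Proof. exact: beta_neq0. Qed.
Let Qbt : Qval bt = b. Proof. by []. Qed.

(** The primes indexing the factors of the representation space. *)
Definition contr_place (w : absval R K) :=
  (infinite_place w /\ ~ is_p1 w) \/ fin_place w.

(** This is where [b] being a Pisot number enters: at an infinite prime [beta]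
   becomes one of the finitely many other conjugates.  At a finite prime dividing
   [beta] its absolute value is at most one half. *)
Lemma contraction_ratio : exists rho : R, [/\ 0 <= rho, rho < 1 &
  forall w, contr_place w -> w bt <= rho].
Proof.
have [_ _ conj_lt1] := hb.
have [rho [r2 r1 rC]] : exists rho : R, [/\ 2^-1 <= rho, rho < 1 &
    forall z, z \in conjugates b -> z != b%:C -> ComplexField.Normc.normc z <= rho].
  elim: (conjugates b) conj_lt1 => [|z s IH] lt1; first by exists 2^-1; split=> //; lra.
  have [|rho [r2 r1 rC]] := IH; first by move=> t ts; apply: lt1; rewrite inE ts orbT.
  have [zb|zb] := eqVneq z b%:C.
    exists rho; split=> // t; rewrite inE => /orP[/eqP->|//]; last exact: rC.
    by rewrite zb eqxx.
  exists (Num.max rho (ComplexField.Normc.normc z)); split.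
  - by rewrite le_max r2.
  - rewrite gt_max r1 /=.
    by have := lt1 z (mem_head _ _) zb; rewrite normc_normr -ltcR.
  - move=> t; rewrite inE le_max => /orP[/eqP->|ts tb]; first by rewrite lexx orbT.
    by rewrite rC.
exists rho; split=> //; first by rewrite (le_trans _ r2) // invr_ge0.
move=> w [[[s ws] np1]|fw]; last exact: le_trans (fin_place_beta_half b_gt1 fw) r2.
have wE x : w x = ComplexField.Normc.normc (s x).
  by have := ws x; rewrite normc_normr => -[].
rewrite wE; apply: rC; first exact: beta_conjugate.
apply/eqP => sb; apply: np1 => x.
have [g gx] := Qbeta_horner b_int x.
rewrite wE (embedding_horner s gx) sb.
have -> : (map_poly ratr g).[b%:C] = (Qval x)%:C.
  rewrite gx -horner_map -map_poly_comp; congr (_.[_]); apply: eq_map_poly => c /=.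
  by rewrite fmorph_rat.
by rewrite /= expr0n /= addr0 sqrtr_sqr.
Qed.

Definition TK (x : K) : K := bt * x - (Num.floor (b * Qval x))%:~R.

Lemma Qval_TK x : Qval (TK x) = T b (Qval x).
Proof. by rewrite /TK QvalD QvalN QvalM Qval_int. Qed.

Lemma Qval_iter_TK k x : Qval (iter k TK x) = iter k (T b) (Qval x).
Proof. by elim: k => [|k IH] //; rewrite !iterS Qval_TK IH. Qed.

(** The set [beta^k T^-k(x)], inside the number field. *)
Definition scaled_pre (k : nat) (x : K) : set K :=
  [set y | Tpre b k (Qval x) (Qval y / b ^+ k)].

Lemma scaled_preE k x y :
  scaled_pre k x y = Tpre b k (Qval x) (Qval y / b ^+ k).
Proof. by []. Qed.

Definition scaled_orbit (x : K) : set K := \bigcup_k scaled_pre k x.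

Lemma tile_approxE x k : tile_approx x k = @delta' R b @` scaled_pre k x.
Proof.
rewrite /tile_approx; congr (_ @` _); apply/seteqP; split=> y /=.
  by move=> [u Tu yu]; rewrite /scaled_pre /= yu mulrAC mulfV ?mul1r // expf_neq0.
by move=> Ty; exists (Qval y / b ^+ k) => //; rewrite mulrC divfK // expf_neq0.
Qed.

Lemma scaled_pre0 x y : scaled_pre 0 x y -> y = x.
Proof.
move=> [_]; rewrite /= expr0 divr1 => /(@Qval_inj R b) //.
Qed.

Lemma scaled_pre_self x : 0 <= Qval x < 1 -> scaled_pre 0 x x.
Proof. by move=> x01; rewrite scaled_preE expr0 divr1. Qed.

(** The digit 0 provides the preimage [u / b] of [u]; so these sets increase with [k],
   and the tile will be the closure of their union. *)
Lemma scaled_preS k x : scaled_pre k x `<=` scaled_pre k.+1 x.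
Proof.
move=> y [u01 uk]; rewrite scaled_preE exprSr invfM mulrA; split; last first.
  by rewrite iterSr T_div.
by move: u01 => /andP[u0 u1]; rewrite divr_ge0 ?(ltW b_gt0) //= ltr_pdivrMr // mul1r (lt_trans u1).
Qed.

Lemma scaled_pre_mono j k x : (j <= k)%N -> scaled_pre j x `<=` scaled_pre k x.
Proof.
move=> /subnK <-; elim: (k - j)%N => [//|n IH] y /IH; exact: scaled_preS.
Qed.

Lemma scaled_pre_split j k x y : scaled_pre (j + k) x y ->
  exists x1, [/\ 0 <= Qval x1 < 1, iter j TK x1 = x, scaled_pre j x (bt ^+ j * x1)
    & scaled_pre k x1 (y / bt ^+ j)].
Proof.
move=> [u01 uk]; set u := Qval y / _ in u01 uk.
exists (iter k TK (y / bt ^+ (j + k))).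
have uE : Qval (y / bt ^+ (j + k)) = u by rewrite QvalM QvalV QvalX.
have x1E : Qval (iter k TK (y / bt ^+ (j + k))) = iter k (T b) u by rewrite Qval_iter_TK uE.
have x1j : Qval (iter k TK (y / bt ^+ (j + k))) / 1 = iter k (T b) u by rewrite divr1.
split.
- by rewrite x1E iter_T_itv.
- by apply: (@Qval_inj R b); rewrite Qval_iter_TK x1E -iterD.
- rewrite scaled_preE QvalM QvalX Qbt mulrAC mulfV ?mul1r ?expf_neq0 // x1E.
  by split; [exact: iter_T_itv|rewrite -iterD].
- rewrite scaled_preE x1E QvalM QvalV QvalX Qbt -mulrA -invfM -exprD.
  by split; rewrite ?[(k + j)%N]addnC // addnC.
Qed.

Lemma scaled_pre_digit k x y : scaled_pre k.+1 x y ->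
  exists d : nat, d%:R <= b /\ scaled_pre k x (y - d%:R * bt ^+ k).
Proof.
move=> [u01 uk]; set u := Qval y / _ in u01 uk.
move: (u01) => /andP[u0 u1].
have [d dE] : exists d : nat, Num.floor (b * u) = d.
  have : 0 <= Num.floor (b * u) by rewrite floor_ge0 mulr_ge0 // ltW.
  by case: Num.floor => // d _; exists d.
exists d; split.
  rewrite -[d%:R]/(d%:Z%:~R) -dE (le_trans (floor_le _)) //.
  by rewrite ler_piMr ?ltW.
have TuE : T b u = Qval (y - d%:R * bt ^+ k) / b ^+ k.
  rewrite QvalD QvalN QvalM QvalX Qbt -[d%:R]/(d%:Z%:~R) Qval_int /T dE /u exprS.
  by field; rewrite b_neq0 expf_neq0.
rewrite scaled_preE -TuE; split; first exact: T_itv.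
by rewrite -iterSr.
Qed.

(** The digits contribute a geometric series. *)
Lemma scaled_pre_bound (rho : R) (w : absval R K) k x y : 0 <= rho -> rho < 1 ->
  w bt <= rho -> scaled_pre k x y -> w (y - x) <= b / (1 - rho).
Proof.
move=> r0 r1 wr Ykxy.
suff : w (y - x) <= b * (1 - rho ^+ k) / (1 - rho).
  move=> /le_trans; apply; rewrite ler_pM2r ?invr_gt0 ?subr_gt0 //.
  by rewrite ler_piMr ?(ltW b_gt0) // gerBl exprn_ge0.
elim: k y Ykxy => [|k IH] y; first by move=> /scaled_pre0 ->; rewrite subrr absv0 expr0 subrr mulr0 mul0r.
move=> /scaled_pre_digit[d [db /IH]]; set z := d%:R * _.
have wz : w z <= b * rho ^+ k.
  rewrite absvM absvX ler_pM ?exprn_ge0 ?absv_ge0 //; last by rewrite lerXn2r ?nnegrE ?absv_ge0.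
  exact: le_trans (absv_nat _ _) db.
move=> IHz; have -> : y - x = (y - z - x) + z by ring.
apply: (le_trans (absvD _ _ _)); apply: (le_trans (lerD IHz wz)).
rewrite le_eqVlt; apply/orP; left; apply/eqP; rewrite exprS; field.
by rewrite subr_eq0 gt_eqF.
Qed.

Lemma scaled_pre_Zbeta k x y : scaled_pre k x y -> Zbeta b (y - x).
Proof.
have sZ := Zbeta_subring b; case: (sZ) => _ _ ZM.
elim: k y => [|k IH] y; first by move=> /scaled_pre0 ->; rewrite subrr; apply: subring0.
move=> /scaled_pre_digit[d [_ /IH]] Zy.
have -> : y - x = (y - d%:R * bt ^+ k - x) + d%:R * bt ^+ k by ring.
apply: subringD => //; apply: ZM; first exact: (subring_int d sZ).
by apply: subringX => //; apply: Zbeta_beta.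
Qed.

Lemma finite_scaled_pre k x : finite_set (scaled_pre k x).
Proof.
elim: k => [|k IH].
  apply: (@sub_finite_set _ _ [set x]); last exact: finite_set1.
  by move=> y /scaled_pre0.
pose D := [set d : nat | (d <= Num.bound b)%N].
have Dfin : finite_set D.
  by apply: (@sub_finite_set _ _ `I_(Num.bound b).+1); [move=> d; rewrite /D /= ltnS|exact: finite_II].
apply: sub_finite_set (finite_image2 (fun y d => y + d%:R * bt ^+ k) IH Dfin).
move=> y /scaled_pre_digit[d [db Yd]]; exists (y - d%:R * bt ^+ k) => //; exists d; last by ring.
rewrite /D /= -(ler_nat R) (le_trans db) // ltW // archi_boundP // ltW //.
Qed.

Lemma scaled_pre_shift k v x y : 0 <= Qval v -> Qval v <= Qval x -> Qval x < hat b (Qval v) ->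
  scaled_pre k v y <-> scaled_pre k x (y + (x - v)).
Proof.
move=> v0 vx xv; rewrite !scaled_preE QvalD QvalD QvalN mulrDl.
exact: Tpre_shift.
Qed.

End BetaAdic.

(** * Backward orbits of null points *)

Section PeriodicPoints.
Variables (R : realType) (b : R).
Hypothesis hb : pisot b.

Local Notation K := (Qbeta b).
Let bt : K := beta b.

Let b_gt1 : 1 < b. Proof. by case: hb. Qed.
Let b_int : integralOver (intr : int -> R) b. Proof. by case: hb. Qed.
Let b_gt0 : 0 < b. Proof. exact: lt_trans b_gt1. Qed.
Let b_neq0 : b != 0. Proof. by rewrite gt_eqF. Qed.
Let bt_neq0 : bt != 0. Proof. exact: beta_neq0. Qed.
Let Qbt : Qval bt = b. Proof. by []. Qed.

(** The recursion [e -> b e - d] with [0 <= d <= b] that produces [Vhat] contracts at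
   the primes of the representation space, so the heights stay bounded. *)
Lemma Vhat_Zbeta (rho : R) : 0 <= rho -> rho < 1 ->
    (forall w, contr_place w -> w bt <= rho) -> forall k,
  exists x : K, [/\ Qval x = T1minus b k, Zbeta b x &
    forall w, contr_place w -> w x <= 1 + b / (1 - rho)].
Proof.
move=> r0 r1 wr; have sZ := Zbeta_subring b; case: (sZ) => _ ZB ZM.
elim=> [|k [x [xk Zx wx]]].
  exists 1; split; [by rewrite (T1minusE b_gt1)|by case: sZ|].
  by move=> w _; rewrite absv1 lerDl divr_ge0 ?ltW // subr_gt0.
have e01 := iter_Tleft_itv b k; rewrite -(T1minusE b_gt1 k) -xk in e01.
have [d dE] : exists d : nat, Num.ceil (b * Qval x) - 1 = d.
  have : 0 <= Num.ceil (b * Qval x) - 1.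
    by rewrite subr_ge0 -gtz0_ge1 ceil_gt0 mulr_gt0 //; case/andP: e01.
  by case: (_ - 1) => // d _; exists d.
have db : d%:R <= b.
  rewrite -[d%:R]/(d%:Z%:~R) -dE ltW // (lt_le_trans (ceilB1_lt _)) //.
  by rewrite ler_piMr ?(ltW b_gt0) //; case/andP: e01.
exists (bt * x - d%:R); split.
- rewrite (T1minusE b_gt1) iterS -(T1minusE b_gt1) -xk /Tleft dE QvalD QvalM QvalN.
  by rewrite -[d%:R in LHS]/(d%:Z%:~R) Qval_int.
- apply: ZB; last exact: (subring_int d sZ).
  by apply: ZM => //; apply: Zbeta_beta.
- move=> w cw; apply: (le_trans (absvD _ _ _)); rewrite absvN absvM.
  have r1' : 0 < 1 - rho by rewrite subr_gt0.
  apply: (@le_trans _ _ (rho * (1 + b / (1 - rho)) + b)).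
    apply: lerD; last exact: le_trans (absv_nat _ _) db.
    by apply: ler_pM; rewrite ?absv_ge0 ?wr ?wx.
  have -> : rho * (1 + b / (1 - rho)) + b = rho + b / (1 - rho).
    by field; rewrite gt_eqF.
  by rewrite lerD2r ltW.
Qed.

Lemma finite_Vhat : finite_set (Vhat b).
Proof.
have [rho [r0 r1 wr]] := contraction_ratio hb.
have Vz := Vhat_Zbeta r0 r1 wr.
have fin := finite_bounded_integers b_int (1 + b / (1 - rho)).
apply: sub_finite_set (finite_image (@Qval R b) fin) => y [k _ <-].
have [x [xk Zx wx]] := Vz k; exists x => //; split.
- exact: Zbeta_integral.
- rewrite xk (T1minusE b_gt1); have /andP[e0 e1] := iter_Tleft_itv b k.
  rewrite gtr0_norm // (le_trans e1) // lerDl divr_ge0 ?(ltW b_gt0) //.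
  by rewrite subr_ge0 ltW.
- by move=> w wi np1; apply: wx; left.
Qed.

Lemma V_itv v : V b v -> 0 <= v < 1.
Proof.
move=> [[/(Vhat_itv b_gt1)/andP[v0 v1]|->] v_neq1]; last by rewrite lexx ltr01.
by rewrite ltW //= lt_neqAle v1 andbT; apply/eqP.
Qed.

Lemma hat_le1 v : v < 1 -> hat b v <= 1.
Proof. by apply: hat_le => //; apply: Vhat1. Qed.

Lemma V_Zbeta v : V b v -> exists2 z : K, Qval z = v & Zbeta b z.
Proof.
have [rho [r0 r1 wr]] := contraction_ratio hb.
move=> [[[k _ <-]|->] _].
  by have [z [zk Zz _]] := Vhat_Zbeta r0 r1 wr k; exists z.
by exists 0; [exact: Qval0|exact: subring0 (Zbeta_subring b)].
Qed.

Lemma V_Qbeta_Zbeta (v : K) : V b (Qval v) -> Zbeta b v.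
Proof. by move=> /V_Zbeta[z /(@Qval_inj R b) ->]. Qed.

(** As [Vhat] is finite, there is a largest element of [V] not exceeding [x],
   and the element of [Vhat] following it lies beyond [x]. *)
Lemma V_cover (x : R) : 0 <= x < 1 ->
  exists v : K, [/\ V b (Qval v), Qval v <= x & x < hat b (Qval v)].
Proof.
move=> /andP[x0 x1].
have [||v [Vv vx] vmax] := @finite_max R (V b `&` [set v | v <= x]).
- apply: (@sub_finite_set _ _ (Vhat b `|` [set 0])); first by move=> v [[]].
  by rewrite finite_setU; split; [exact: finite_Vhat|exact: finite_set1].
- by exists 0; split=> //; split; [right|move=> /= /eqP; rewrite eq_sym oner_eq0].
have [z zv _] := V_Zbeta Vv; exists z; rewrite zv; split=> //.
have [||m [Vm vm] mmin] := @finite_min R (Vhat b `&` [set y | v < y]).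
- by apply: sub_finite_set finite_Vhat => y [].
- by exists 1; split; [exact: Vhat1 b_gt1|exact: le_lt_trans x1].
apply: (@lt_le_trans _ _ m).
  rewrite ltNge; apply/negP => mx; have := vmax m; rewrite leNgt vm => mV.
  suff /mV : (V b `&` [set v | v <= x]) m by [].
  split=> //; split; first by left.
  by move=> /= m1; move: mx; rewrite m1 leNgt x1.
by apply: lb_le_inf; [exists m|move=> y; exact: mmin].
Qed.

(** The point 0 of the representation space is adherent to the union of the sets
   [beta^k T^-k(x)].  After translation by [v - x] this says that [v - x] lies in the
   tile of [v]; unlike that condition it does not refer to [v], and it passes to
   preimages of [x]. *)
Definition null_point (x : K) := exists G : set_system K,
  [/\ ProperFilter G, G (scaled_orbit x) &
    forall w, contr_place w -> w y @[y --> G] --> (0 : R)].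

(** As [x] has finitely many preimages [x1] in the field, the filter has a trace on
   [beta] times the orbit of one of them. *)
Lemma null_point_back (x : K) : null_point x -> exists x1 : K,
  [/\ 0 <= Qval x1 < 1, TK x1 = x & null_point x1].
Proof.
move=> [G [PG Gx Gw]].
pose A (x1 : K) := [set y | TK x1 = x /\ scaled_orbit x1 (y / bt)].
pose D := [set x1 : K | scaled_pre 1 x (bt * x1) /\ TK x1 = x].
have Dfin : finite_set D.
  apply: sub_finite_set (finite_image (fun z => z / bt) (finite_scaled_pre hb 1 x)).
  by move=> x1 [Yx1 _]; exists (bt * x1) => //; rewrite mulrC mulKf.
have GA : G (\bigcup_(x1 in D) A x1).
  apply: filterS Gx => y [k _ Yk].
  have : scaled_pre (1 + k) x y by apply: scaled_pre_mono Yk; rewrite ?leq_addl.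
  move=> /(scaled_pre_split hb)[x1 [x1_01 x1x Yx1 Yk1]].
  by exists x1; [split|split=> //; exists k].
have [x1 [Yx1 x1x] PG1] := filter_finite_split PG Dfin GA.
exists x1; split=> //; first by have [+ _] := Yx1; rewrite expr1 QvalM Qbt mulrC mulKf.
exists ((fun y => y / bt) @ within (A x1) G); split.
- exact: fmap_proper_filter.
- by apply: (@filterE _ G) => y [].
- move=> w cw; have := Gw w cw => {}Gw.
  have : w (y / bt) @[y --> G] --> (0 : R).
    under eq_fun do rewrite absvM.
    by rewrite -[0](mul0r (w bt^-1)); apply: cvgM => //; apply: cvg_cst.
  by move=> cv P P0; apply: (@filterS _ G) (cv P P0) => y.
Qed.

(** Elements of the orbit of [x] differ from [x] by a bounded amount, and by an
   element of [Z[beta]]; some of them are close to 0. *)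
Lemma null_point_bound (x : K) (rho : R) : 0 <= rho -> rho < 1 ->
    (forall w, contr_place w -> w bt <= rho) -> null_point x ->
  (forall w, contr_place w -> w x <= 1 + b / (1 - rho)) /\
  (forall w, fin_place w -> w x <= 1).
Proof.
move=> r0 r1 wr [G [PG Gx Gw]].
have near1 w : contr_place w -> exists2 y, scaled_orbit x y & w y < 1.
  move=> cw; have := Gw w cw => /cvgr_lt/(_ 1 ltr01) G1.
  by have [y [xy y1]] := filter_ex (filterI Gx G1); exists y.
split=> w cw.
  have [y [k _ Yk] y1] := near1 w cw.
  have -> : x = y - (y - x) by rewrite subKr.
  apply: (le_trans (absvD _ _ _)); rewrite absvN; apply: lerD; first exact: ltW.
  exact: (scaled_pre_bound hb r0 r1 (wr _ cw) Yk).
have [y [k _ Yk] y1] := near1 w (or_intror cw).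
have -> : x = y - (y - x) by rewrite subKr.
have sw := ultra_subring (let: conj (And3 wU _ _) _ := cw in wU).
case: (sw) => _ wB _; apply: wB; first exact: ltW.
apply: fin_place_Zbeta => //; exact: scaled_pre_Zbeta Yk.
Qed.

(** There is an infinite backward orbit of null points that ends in [x].  Its points
   have a common denominator and bounded height, so the orbit repeats; applying [T]
   to a repetition shows that [x] is periodic. *)
Lemma null_point_pure (x : K) (p q : int) : 0 <= Qval x < 1 ->
  q != 0 -> q%:~R * x = p%:~R -> null_point x -> Pur b (Qval x).
Proof.
move=> x01 q0 qx nx; have [rho [r0 r1 wr]] := contraction_ratio hb.
pose good z := 0 <= Qval z < 1 /\ null_point z.
pose back z := xget z [set z1 | good z1 /\ TK z1 = z].
have backP z : good z -> good (back z) /\ TK (back z) = z.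
  move=> [z01 /null_point_back[z1 [z1_01 z1z nz1]]].
  exact: (@xgetI _ z [set z1 | good z1 /\ TK z1 = z] z1).
pose X n := iter n back x.
have Xgood n : good (X n).
  by elim: n => [|n IH] //; have [] := backP _ IH.
have XT n : iter n (@TK R b) (X n) = x.
  elim: n => [|n IH] //; rewrite iterSr /X iterS.
  by have [_ ->] := backP _ (Xgood n).
have sZ := Zbeta_subring b; case: (sZ) => _ ZB ZM.
pose M := 1 + b / (1 - rho).
have M1 : 1 <= M by rewrite lerDl divr_ge0 ?(ltW b_gt0) // subr_ge0 ltW.
pose S := [set z : K | [/\ integralOver (intr : int -> R) (Qval z),
  `|Qval z| <= `|q|%:~R * M & forall w : absval R K, infinite_place w -> ~ is_p1 w ->
  w z <= `|q|%:~R * M]].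
have wq (w : absval R K) : w q%:~R <= `|q|%:~R.
  rewrite {1}[q]intEsign rmorphM rmorph_sign /= absvM.
  have -> : w ((-1) ^+ (q < 0)%R) = 1 by case: (q < 0); rewrite ?expr1 ?absvN ?expr0 absv1.
  by rewrite mul1r (le_trans (absv_nat _ _)) // natr_absz.
have XS n : S (q%:~R * X n).
  have [/andP[X0 X1] nX] := Xgood n.
  have [bX fX] := null_point_bound r0 r1 wr nX.
  split.
  - apply: (@integral_of_fin_places _ _ b_int b_gt1 _ n).
      have YX : scaled_pre n x (bt ^+ n * X n).
        rewrite scaled_preE QvalM QvalX Qbt mulrAC mulfV ?mul1r ?expf_neq0 //.
        by split; rewrite ?X0 // -Qval_iter_TK XT.
      have -> : bt ^+ n * (q%:~R * X n) = q%:~R * (bt ^+ n * X n - x) + p%:~R.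
        by rewrite -qx; ring.
      apply: subringD => //; last exact: subring_int.
      by apply: ZM; [exact: subring_int|exact: scaled_pre_Zbeta YX].
    move=> w fw; rewrite absvM mulr_ile1 ?absv_ge0 ?fX //.
    by case: (fw) => -[wU _ _] _; apply: ultra_int.
  - rewrite QvalM Qval_int normrM -intr_norm ler_wpM2l ?ler0z //.
    by rewrite ger0_norm // (le_trans _ M1) // ltW.
  - move=> w wi np1; rewrite absvM ler_pM ?absv_ge0 //.
    by apply: bX; left.
have [i [j [ij Xij]]] : exists i j, (i < j)%N /\ X i = X j.
  apply: contrapT => no; apply: infinite_nat.
  have -> : [set: nat] = (fun n => q%:~R * X n) @^-1` S.
    by apply/seteqP; split=> n //= _; apply: XS.
  apply: finite_preimage; last exact: finite_bounded_integers.
  move=> i j _ _ /mulfI; rewrite intr_Qbeta_eq0 => /(_ q0) Xij.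
  by case: (ltngtP i j) => // lt; case: no; [exists i, j|exists j, i].
split=> //; exists (j - i)%N; first by rewrite subn_gt0.
rewrite -Qval_iter_TK -{1}(XT i) Xij -iterD subnK ?XT //; exact: ltnW.
Qed.

End PeriodicPoints.

(** * Convergence in the representation space *)

Section Convergence.

Lemma cvg_prodP (I T : Type) (X : I -> topologicalType) (G : set_system T)
    (f : T -> prod_topology X) (z : prod_topology X) : Filter G ->
  f t @[t --> G] --> z <-> forall i, f t i @[t --> G] --> z i.
Proof.
move=> FG; rewrite cvg_sup; split=> cv i; have := cv i => {}cv.
  move=> A /(@initial_continuous _ _ (fun g : forall i, X i => g i) z) /cv.
  by [].
move=> A /= [_ [[B Bop <-] Bz sBA]].
apply: filterS sBA _; apply: cv; exact: open_nbhs_nbhs.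
Qed.

Lemma cvg_mdistP (R : realType) (T : Type) (X : metricType R) (G : set_system T)
    (f : T -> X) (z : X) : Filter G ->
  f t @[t --> G] --> z <-> forall e : R, 0 < e -> \forall t \near G, mdist z (f t) < e.
Proof.
move=> FG; rewrite cvg_ballP; split=> cv e e0; have := cv e e0; apply: filterS => t.
  by rewrite ballEmdist.
by rewrite ballEmdist.
Qed.

(** Describing adherent points by filters on the index type reduces statements about
   closures to convergence at each prime separately. *)
Lemma closure_imageP (T : Type) (X : topologicalType) (f : T -> X) (S : set T) (z : X) :
  closure (f @` S) z <-> exists G : set_system T,
    [/\ ProperFilter G, G S & f t @[t --> G] --> z].
Proof.
split=> [Sz|[G [PG GS fz]] W Wz]; last first.
  have GW : G (f @^-1` W) by apply: fz.
  by have [t [St Wt]] := filter_ex (filterI GS GW); exists (f t); split=> //; exists t.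
exists (fun A => exists2 W, nbhs z W & S `&` (f @^-1` W) `<=` A); split.
- split.
    by move=> [W /Sz[_ [[t St <-] Wt]] sub]; apply: (sub t).
  split.
  + by exists setT => //; apply: filterT.
  + move=> A B [W Wz WA] [V Vz VB]; exists (W `&` V); first exact: filterI.
    by move=> t [St [Wt Vt]]; split; [apply: WA|apply: VB].
  + by move=> A B AB [W Wz WA]; exists W => //; apply: subset_trans AB.
- by exists setT; [exact: filterT|move=> t []].
- by move=> W Wz; exists W => // t [].
Qed.

End Convergence.

Section CompletionDistance.
Variables (R : realType) (K : fieldType) (w : absval R K).

Lemma mdist_to_completion (x y : K) :
  mdist (to_completion w x) (to_completion w y) = w (x - y).
Proof.
have cstE (c : K) : seq_dist (repr (to_completion w c)) (CauchySeq (cst_cauchy w c)) = 0.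
  apply/eqP; rewrite -[_ == 0]/(cseq_equiv _ _).
  by apply/eqmodP; rewrite reprK.
rewrite -[LHS]/(seq_dist (repr (to_completion w x)) (repr (to_completion w y))).
have xy : seq_dist (CauchySeq (cst_cauchy w x)) (CauchySeq (cst_cauchy w y)) = w (x - y).
  by rewrite /seq_dist /= lim_cst.
apply/eqP; rewrite eq_le -xy; apply/andP; split.
  apply: (le_trans (seq_dist_triangle (CauchySeq (cst_cauchy w x)) _ _)).
  rewrite cstE add0r.
  apply: (le_trans (seq_dist_triangle (CauchySeq (cst_cauchy w y)) _ _)).
  by rewrite [X in _ + X]seq_dist_sym cstE addr0.
apply: (le_trans (seq_dist_triangle (repr (to_completion w x)) _ _)).
rewrite seq_dist_sym cstE add0r.
apply: (le_trans (seq_dist_triangle (repr (to_completion w y)) _ _)).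
by rewrite cstE addr0.
Qed.

End CompletionDistance.

Section RepresentationSpaceConvergence.
Variables (R : realType) (b : R).
Local Notation K := (Qbeta b).

Lemma cvg_delta_f (T : Type) (G : set_system T) (f : T -> K) (a : K) : Filter G ->
  delta_f b (f t) @[t --> G] --> delta_f b a <->
  forall w, fin_place w -> forall e : R, 0 < e -> \forall t \near G, w (a - f t) < e.
Proof.
move=> FG; rewrite cvg_prodP; split=> [cv w fw e e0|cv p].
  have /cvg_mdistP/(_ e e0) := cv (exist _ w fw).
  by apply: filterS => t; rewrite mdist_to_completion.
apply/cvg_mdistP => e e0; have := cv _ (svalP p) e e0.
by apply: filterS => t; rewrite mdist_to_completion.
Qed.

Lemma cvg_delta_inf' (T : Type) (G : set_system T) (f : T -> K) (a : K) : Filter G ->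
  @delta_inf' R b (f t) @[t --> G] --> @delta_inf' R b a <->
  forall w, infinite_place w -> ~ is_p1 w ->
    forall e : R, 0 < e -> \forall t \near G, w (a - f t) < e.
Proof.
move=> FG; rewrite cvg_prodP; split=> [cv w iw np1 e e0|cv p].
  have /cvg_mdistP/(_ e e0) := cv (exist _ w (conj iw np1)).
  by apply: filterS => t; rewrite mdist_to_completion.
have [iw np1] := svalP p.
apply/cvg_mdistP => e e0; have := cv _ iw np1 e e0.
by apply: filterS => t; rewrite mdist_to_completion.
Qed.

Lemma cvg_delta' (T : Type) (G : set_system T) (f : T -> K) (a : K) : Filter G ->
  @delta' R b (f t) @[t --> G] --> @delta' R b a <->
  forall w, contr_place w -> forall e : R, 0 < e -> \forall t \near G, w (a - f t) < e.
Proof.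
move=> FG; split=> [cv w|cv].
  have cv1 : @delta_inf' R b (f t) @[t --> G] --> @delta_inf' R b a.
    exact: cvg_trans (cvg_app fst cv) (@cvg_fst _ _ _ _ _).
  have cv2 : delta_f b (f t) @[t --> G] --> delta_f b a.
    exact: cvg_trans (cvg_app snd cv) (@cvg_snd _ _ _ _ _).
  case=> [[iw np1]|fw].
    by have [cvw _] := cvg_delta_inf' f a FG; apply: cvw cv1 w iw np1.
  by have [cvw _] := cvg_delta_f f a FG; apply: cvw cv2 w fw.
have cv1 : @delta_inf' R b (f t) @[t --> G] --> @delta_inf' R b a.
  by apply/cvg_delta_inf' => w iw np1; apply: cv; left.
have cv2 : delta_f b (f t) @[t --> G] --> delta_f b a.
  by apply/cvg_delta_f => w fw; apply: cv; right.
exact: (cvg_pair cv1 cv2).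
Qed.

End RepresentationSpaceConvergence.

(** * Tiles as closures *)

Section HausdorffDistance.
Variables (R : realType) (b : R).
Implicit Types (y z : Kbeta' b) (A B : set (Kbeta' b)) (c e : R).
Local Open Scope ereal_scope.

Lemma Kdist_ge0 y z : 0 <= Kdist y z.
Proof. by apply: ereal_sup_ubound; left; left. Qed.

Lemma Kdist_le y z c : (0 <= c)%R ->
  (forall p, (mdist (y.1 p) (z.1 p) <= c)%R) ->
  (forall p, (mdist (y.2 p) (z.2 p) <= c)%R) -> Kdist y z <= c%:E.
Proof.
move=> c0 le1 le2; apply: ge_ereal_sup => _ [[->|[p _ <-]]|[p _ <-]];
  by rewrite lee_fin.
Qed.

Lemma Kdist_refl y : Kdist y y = 0.
Proof.
apply/eqP; rewrite eq_le Kdist_ge0 andbT.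
by apply: Kdist_le => // p; rewrite mdistxx.
Qed.

Lemma Kdist_sym y z : Kdist y z = Kdist z y.
Proof.
rewrite /Kdist; congr (ereal_sup (_ `|` _ `|` _));
  by apply: eq_imagel => p _; rewrite metric_sym.
Qed.

Lemma cvg_Kdist (T : Type) (G : set_system T) (f : T -> Kbeta' b) z : Filter G ->
  (forall e, (0 < e)%R -> \forall t \near G, Kdist z (f t) < e%:E) ->
  f t @[t --> G] --> z.
Proof.
move=> FG cv.
have cv1 : (f t).1 @[t --> G] --> z.1.
  apply/cvg_prodP => p; apply/cvg_mdistP => e e0; apply: filterS (cv e e0) => t.
  rewrite -lte_fin; apply: le_lt_trans; apply: ereal_sup_ubound.
  by left; right; exists p.
have cv2 : (f t).2 @[t --> G] --> z.2.
  apply/cvg_prodP => p; apply/cvg_mdistP => e e0; apply: filterS (cv e e0) => t.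
  rewrite -lte_fin; apply: le_lt_trans; apply: ereal_sup_ubound.
  by right; exists p.
have -> : f = (fun t => ((f t).1, (f t).2)) by apply/funext => t; case: (f t).
case: z cv1 cv2 {cv} => z1 z2 /= cv1 cv2; exact: (cvg_pair cv1 cv2).
Qed.

Lemma hausdorff_dist_ltl A B e : hausdorff_dist A B < e%:E ->
  forall y, A y -> exists2 z, B z & Kdist y z < e%:E.
Proof.
rewrite /hausdorff_dist gt_max => /andP[AB _] y Ay.
have /ereal_inf_lt[_ [z Bz <-] lt] : ereal_inf [set Kdist y z | z in B] < e%:E.
  by apply: le_lt_trans AB; apply: ereal_sup_ubound; exists y.
by exists z.
Qed.

Lemma hausdorff_dist_ltr A B e : hausdorff_dist A B < e%:E ->
  forall z, B z -> exists2 y, A y & Kdist y z < e%:E.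
Proof.
rewrite /hausdorff_dist gt_max => /andP[_ AB] z Bz.
have /ereal_inf_lt[_ [y Ay <-] lt] : ereal_inf [set Kdist y z | y in A] < e%:E.
  by apply: le_lt_trans AB; apply: ereal_sup_ubound; exists z.
by exists y.
Qed.

Lemma closure_Kdist B z :
  (forall e, (0 < e)%R -> exists2 y, B y & Kdist z y < e%:E) -> closure B z.
Proof.
move=> ex.
have /choice[u uP] : forall n, exists y, B y /\ Kdist z y < (n.+1%:R^-1)%:E.
  by move=> n; have [|y] := ex n.+1%:R^-1%R; [rewrite invr_gt0 ltr0n|exists y].
have cv : u n @[n --> \oo] --> z.
  apply: cvg_Kdist => e e0; have := near_infty_natSinv_lt (PosNum e0).
  by apply: filterS => n en; apply: lt_trans (proj2 (uP n)) _; rewrite lte_fin.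
move=> W Wz; have Wu : (\oo : set_system nat) (u @^-1` W) := cv W Wz.
have [n Wn] := filter_ex Wu.
by exists (u n); split=> //; case: (uP n).
Qed.

(** The Hausdorff distance uses the supremum over all primes, so convergence for it
   is stronger than convergence in the product topology. *)
Lemma hausdorff_limit_closure (A : nat -> set (Kbeta' b)) B :
  (forall j k, (j <= k)%N -> A j `<=` A k) -> closed B ->
  hausdorff_dist (A k) B @[k --> \oo] --> 0 -> B = closure (\bigcup_k A k).
Proof.
move=> Amono Bcl AB.
have AB_lt e : (0 < e)%R -> \forall k \near \oo, hausdorff_dist (A k) B < e%:E.
  by move=> e0; apply: (AB [set x | x < e%:E]); apply: open_ereal_lt'; rewrite lte_fin.
apply/seteqP; split=> z.
  move=> Bz; apply: closure_Kdist => e e0; have [k ke] := filter_ex (AB_lt _ e0).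
  have [y Ay yz] := hausdorff_dist_ltr ke Bz.
  by exists y; [exists k|rewrite Kdist_sym].
rewrite [X in _ -> X z](closure_id B).1 //.
apply: closureS => {}z [j _ Ajz]; rewrite (closure_id B).1 //.
apply: closure_Kdist => e e0.
have [k [ke jk]] := filter_ex (filterI (AB_lt _ e0) (nbhs_infty_ge j)).
exact: hausdorff_dist_ltl ke _ (Amono _ _ jk _ Ajz).
Qed.

End HausdorffDistance.

Section Tiles.
Variables (R : realType) (b : R).
Hypothesis hb : pisot b.

Local Notation K := (Qbeta b).
Let bt : K := beta b.

Let b_gt1 : 1 < b. Proof. by case: hb. Qed.
Let b_gt0 : 0 < b. Proof. exact: lt_trans b_gt1. Qed.

(** Each point of the orbit is near one of the finitely many points of the [k]-th
   approximation; a point of the closure is a limit of points near the same one.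
   This gives a bound at all primes at once, as the Hausdorff distance requires. *)
Lemma closure_scaled_orbit_near (rho : R) (x : K) (z : Kbeta' b) k :
    0 <= rho -> rho < 1 -> (forall w, contr_place w -> w bt <= rho) ->
    closure (@delta' R b @` scaled_orbit x) z ->
  exists2 y, scaled_pre k x y &
    (Kdist (delta' y) z <= (b / (1 - rho) * rho ^+ k)%:E)%E.
Proof.
move=> r0 r1 wr /closure_imageP[G [PG Gx Gz]].
pose A y' := [set y : K | forall w, contr_place w -> w (y' - y) <= b / (1 - rho) * rho ^+ k].
have C0 : 0 <= b / (1 - rho) * rho ^+ k.
  by rewrite mulr_ge0 ?exprn_ge0 // divr_ge0 ?(ltW b_gt0) // subr_ge0 ltW.
have GA : G (\bigcup_(y' in scaled_pre k x) A y').
  apply: filterS Gx => y [m _ Ym].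
  have : scaled_pre (k + m) x y by apply: scaled_pre_mono Ym; rewrite ?leq_addl.
  move=> /(scaled_pre_split hb)[x1 [_ _ Yk Ym1]]; exists (bt ^+ k * x1) => // w cw.
  have -> : bt ^+ k * x1 - y = - (bt ^+ k * (y / bt ^+ k - x1)).
    by field; rewrite expf_neq0 // beta_neq0.
  rewrite absvN absvM absvX mulrC; apply: ler_pM; rewrite ?exprn_ge0 ?absv_ge0 //.
    exact: (scaled_pre_bound hb r0 r1 (wr _ cw) Ym1).
  by rewrite lerXn2r ?nnegrE ?absv_ge0 ?wr.
have [y' Yy' PGA] := filter_finite_split PG (finite_scaled_pre hb k x) GA.
exists y' => //; have near_ex (P : set K) : G P -> exists2 y, A y' y & P y.
  move=> GP; have : within (A y') G (A y' `&` P).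
    by apply: (@filterS _ G _ P) => // y Py Ay.
  by move=> /filter_ex[y []]; exists y.
have triangle (X : metricType R) (u t : X) (c : R) :
    (forall e, 0 < e -> exists2 a, mdist u a <= c & mdist t a < e) -> mdist u t <= c.
  move=> ex; apply/ler_addgt0Pr => e e0; have [a ua ta] := ex e e0.
  by apply: (le_trans (metric_triangle _ a _)); rewrite lerD // metric_sym ltW.
have cv1 : (delta' y).1 @[y --> G] --> z.1.
  exact: cvg_trans (cvg_app fst Gz) (@cvg_fst _ _ _ _ _).
have cv2 : (delta' y).2 @[y --> G] --> z.2.
  exact: cvg_trans (cvg_app snd Gz) (@cvg_snd _ _ _ _ _).
have near1 p e : 0 < e -> G [set y | mdist (z.1 p) ((delta' y).1 p) < e].
  move=> e0; have [cvp _] := cvg_prodP (fun y : K => (delta' y).1) z.1 (G := G) _.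
  by have [cve _] := cvg_mdistP (fun y : K => (delta' y).1 p) (z.1 p) (G := G) _; exact: cve (cvp cv1 p) e e0.
have near2 p e : 0 < e -> G [set y | mdist (z.2 p) ((delta' y).2 p) < e].
  move=> e0; have [cvp _] := cvg_prodP (fun y : K => (delta' y).2) z.2 (G := G) _.
  by have [cve _] := cvg_mdistP (fun y : K => (delta' y).2 p) (z.2 p) (G := G) _; exact: cve (cvp cv2 p) e e0.
apply: Kdist_le => // p; apply: triangle => // e e0.
  have [y Ay yz] := near_ex _ (near1 p e e0).
  exists ((delta' y).1 p) => //; rewrite mdist_to_completion; apply: Ay.
  by left; exact: svalP p.
have [y Ay yz] := near_ex _ (near2 p e e0).
exists ((delta' y).2 p) => //; rewrite mdist_to_completion; apply: Ay.
by right; exact: svalP p.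
Qed.

(** The approximations increase and approach the closure of their union at the rate
   [rho^k], so the limit defining the tile exists. *)
Lemma tileE (x : K) : 0 <= Qval x < 1 ->
  tile x = closure (@delta' R b @` scaled_orbit x).
Proof.
move=> x01; have [rho [r0 r1 wr]] := contraction_ratio hb.
have amono j k : (j <= k)%N -> tile_approx x j `<=` tile_approx x k.
  by move=> jk; rewrite !tile_approxE //; apply: image_subset; apply: scaled_pre_mono.
have UE : \bigcup_k tile_approx x k = @delta' R b @` scaled_orbit x.
  by rewrite /scaled_orbit image_bigcup; apply: eq_bigcupr => k _; rewrite tile_approxE.
pose conv A := closed A /\ (hausdorff_dist (tile_approx x k) A @[k --> \oo] --> 0)%E.
have : conv (tile x).
  apply: (@xgetPex _ set0 conv); exists (closure (@delta' R b @` scaled_orbit x)).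
  split; first exact: closed_closure.
  set A := closure _.
  apply: (@squeeze_cvge _ _ _ _ (fun=> 0%E) _ (fun k => (b / (1 - rho) * rho ^+ k)%:E)).
  - near=> k.
    have [y0 Ay0] : tile_approx x k !=set0.
      exists (delta' x); rewrite tile_approxE //; exists x => //.
      by apply: scaled_pre_mono (scaled_pre_self x01).
    have aA : tile_approx x k `<=` A.
      by apply: subset_trans (@subset_closure _ _); rewrite -UE; exact: bigcup_sup.
    apply/andP; split.
      rewrite /hausdorff_dist le_max; apply/orP; left.
      apply: (@le_trans _ _ (ereal_inf [set Kdist y0 z | z in A])).
        by apply: le_ereal_inf_tmp => _ [z _ <-]; exact: Kdist_ge0.
      by apply: ereal_sup_ubound; exists y0.
    rewrite /hausdorff_dist ge_max; apply/andP; split; apply: ge_ereal_sup => _ [y Ay <-].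
      apply: (@le_trans _ _ 0%E).
        by rewrite -(Kdist_refl y); apply: ereal_inf_lbound; exists y => //; apply: aA.
      by rewrite lee_fin mulr_ge0 ?exprn_ge0 // divr_ge0 ?(ltW b_gt0) // subr_ge0 ltW.
    have [y' Yy' le] := closure_scaled_orbit_near k r0 r1 wr Ay.
    apply: le_trans le; apply: ereal_inf_lbound; exists (delta' y') => //.
    by rewrite tile_approxE //; exists y'.
  - exact: cvg_cst.
  - apply: cvg_EFin; first by near=> k.
    rewrite [X in _ --> X](_ : _ = b / (1 - rho) * 0); last by rewrite mulr0.
    apply: cvgM; first exact: cvg_cst.
    by apply: cvg_expr; rewrite ger0_norm.
move=> [cl cv]; rewrite -UE; exact: hausdorff_limit_closure.
Unshelve. all: by end_near.
Qed.

End Tiles.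

(** * Pure periodicity and tiles *)

Section PurelyPeriodicTiles.
Variables (R : realType) (b : R).
Hypothesis hb : pisot b.

Local Notation K := (Qbeta b).
Let bt : K := beta b.

Let b_gt1 : 1 < b. Proof. by case: hb. Qed.
Let b_int : integralOver (intr : int -> R) b. Proof. by case: hb. Qed.
Let b_gt0 : 0 < b. Proof. exact: lt_trans b_gt1. Qed.
Let b_neq0 : b != 0. Proof. by rewrite gt_eqF. Qed.
Let Qbt : Qval bt = b. Proof. by []. Qed.

(** Translating by [x - v] carries the sets defining the tile of [v] to the
   corresponding sets for [x]. *)
Lemma tile_null_point (v x : K) : 0 <= Qval v < 1 -> Qval v <= Qval x ->
  Qval x < hat b (Qval v) -> tile v (delta' (v - x)) -> null_point x.
Proof.
move=> v01 vx xv; have /andP[v0 v1] := v01.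
rewrite (tileE hb) // => /closure_imageP[G [PG Gv Gcv]].
exists ((fun y => y + (x - v)) @ G); split.
- exact: fmap_proper_filter.
- apply: (@filterS _ G _ (scaled_orbit v)) Gv => y [k _ Yk]; exists k => //.
  by have [shift _] := scaled_pre_shift hb k y v0 vx xv; apply: shift.
- move=> w cw; have [/(_ Gcv w cw) cv _] := cvg_delta' id (v - x) (G := G) _.
  suff : w (y + (x - v)) @[y --> G] --> (0 : R) by [].
  apply/cvgr0Pnorm_lt => e e0; apply: filterS (cv e e0) => y.
  by rewrite ger0_norm ?absv_ge0 // -(absvN w (y + _)) (_ : - (y + (x - v)) = v - x - y) //; ring.
Qed.

(** If [T^n x = x] then [beta^(nm) x] lies in [beta^(nm) T^-(nm)(x)] and tends
   to 0 in the representation space. *)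
Lemma pure_tile (v x : K) : 0 <= Qval v < 1 -> Qval v <= Qval x ->
  Qval x < hat b (Qval v) -> Pur b (Qval x) -> tile v (delta' (v - x)).
Proof.
move=> v01 vx xv [x01 [n n0 xn]]; have /andP[v0 v1] := v01.
rewrite (tileE hb) //; apply/closure_imageP.
pose y m := bt ^+ (n * m) * x + (v - x).
have itn m : iter (n * m) (T b) (Qval x) = Qval x.
  by elim: m => [|m IH]; rewrite ?muln0 // mulnS iterD IH.
exists (y m @[m --> \oo]); split.
- exact: fmap_proper_filter.
- apply: (@filterE _ \oo) => m; exists (n * m)%N => //.
  have [_ shift] := scaled_pre_shift hb (n * m) (y m) v0 vx xv; apply: shift.
  have -> : y m + (x - v) = bt ^+ (n * m) * x by rewrite /y; ring.
  by rewrite scaled_preE QvalM QvalX Qbt mulrAC mulfV ?mul1r ?expf_neq0.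
- suff : delta' (y m) @[m --> \oo] --> delta' (v - x) by [].
  apply/cvg_delta' => w cw e e0.
  have [rho [r0 r1 wr]] := contraction_ratio hb.
  have wb1 : w bt ^+ n < 1.
    by rewrite exprn_ilt1 ?absv_ge0 -?lt0n // (le_lt_trans (wr _ cw)).
  have cv : w x * (w bt ^+ n) ^+ m @[m --> \oo] --> w x * 0.
    by apply: cvgM; [exact: cvg_cst|apply: cvg_expr; rewrite ger0_norm // exprn_ge0 ?absv_ge0].
  rewrite mulr0 in cv; have /cvgr0Pnorm_lt/(_ e e0) := cv.
  apply: filterS => m; rewrite ger0_norm ?mulr_ge0 ?exprn_ge0 ?absv_ge0 //.
  rewrite (_ : v - x - y m = - (bt ^+ (n * m) * x)); last by rewrite /y; ring.
  by rewrite absvN absvM absvX exprM mulrC.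
Qed.

Lemma ratr_frac (x : rat) (p q : int) : q != 0 -> x = p%:~R / q%:~R ->
  ratr x = p%:~R / q%:~R :> K.
Proof.
move=> q0 ->; apply: Qval_inj; rewrite Qval_rat QvalM QvalV !Qval_int.
by rewrite fmorph_div /= !ratr_int.
Qed.

Lemma ratrD_Qbeta (x y : rat) : ratr (x + y) = ratr x + ratr y :> K.
Proof. by apply: Qval_inj; rewrite QvalD !Qval_rat rmorphD. Qed.

Lemma absv_infinite_rat (w : absval R K) (x : rat) :
  infinite_place w -> w (ratr x) = `|ratr x|.
Proof.
move=> [s ws]; have := ws (ratr x); rewrite fmorph_rat.
have -> : ratr x = (ratr x : R)%:C%C :> R[i]%C by rewrite fmorph_rat.
by rewrite normc_normr => -[->]; rewrite /= expr0n /= addr0 sqrtr_sqr.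
Qed.

Lemma fin_place_coprime (w : absval R K) (N q : int) : fin_place w ->
  N%:~R = alg_norm b -> coprimez q N -> w q%:~R = 1.
Proof.
move=> fw NE qN; case: (fw) => -[wU _ _] _; apply: (ultra_coprime wU qN).
apply: le_lt_trans (fin_place_norm _ b_gt1 fw NE) _; first by case: hb.
by rewrite invf_lt1 // ltr1n.
Qed.

(** A denominator prime to the norm is invertible modulo all powers of the norm. *)
Lemma ZN_approx (x : rat) m : ZN b x -> exists c : int,
  forall w : absval R K, fin_place w -> w (ratr x - c%:~R) <= 2^-1 ^+ m.
Proof.
move=> [p [q [N [q0 xE NE qN]]]].
have /coprimezP[[u t] /= ut] : coprimez q (N ^+ m) by apply: coprimezXr.
exists (p * u) => w fw; case: (fw) => -[wU _ _] _.
have q0' : q%:~R != 0 :> K by rewrite intr_Qbeta_eq0.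
have -> : ratr x - (p * u)%:~R = p%:~R * t%:~R * N%:~R ^+ m / q%:~R :> K.
  rewrite (ratr_frac q0 xE); apply: (mulIf q0'); rewrite mulrBl !divfK //.
  rewrite [X in X - _](_ : _ = (p * (u * q + t * N ^+ m))%:~R); last by rewrite ut mulr1.
  rewrite !(intrD, intrM) rmorphXn /=; ring.
rewrite !absvM absvV (fin_place_coprime fw NE qN) invr1 mulr1 absvX.
rewrite -[leRHS]mul1r; apply: ler_pM; rewrite ?mulr_ge0 ?exprn_ge0 ?absv_ge0 //.
  by rewrite mulr_ile1 ?absv_ge0 ?ultra_int.
rewrite lerXn2r ?nnegrE ?absv_ge0 ?invr_ge0 //.
by apply: fin_place_norm NE => //; case: hb.
Qed.

Lemma ZN_closure (v : K) (x : rat) : Zbeta b v -> ZN b x ->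
  closure (delta_f b @` Zbeta b) (delta_f b (v - ratr x)).
Proof.
move=> Zv Zx; have /choice[c cP] := fun m => ZN_approx m Zx.
have sZ := Zbeta_subring b.
apply/closure_imageP; exists (v - (c m)%:~R @[m --> \oo]); split.
- exact: fmap_proper_filter.
- apply: (@filterE _ \oo) => m; case: (sZ) => _ ZB _; apply: ZB => //.
  exact: subring_int.
- suff : delta_f b (v - (c m)%:~R) @[m --> \oo] --> delta_f b (v - ratr x) by [].
  apply/cvg_delta_f => w fw e e0.
  have half : `|2^-1 : R| < 1 by rewrite ger0_norm ?invr_ge0 // invf_lt1 // ltr1n.
  have /cvgr0Pnorm_lt/(_ e e0) := cvg_expr half.
  apply: filterS => m; rewrite ger0_norm ?exprn_ge0 ?invr_ge0 //; apply: le_lt_trans.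
  apply: le_trans (cP m w fw); rewrite absv_distC.
  by rewrite (_ : v - (c m)%:~R - (v - ratr x) = ratr x - (c m)%:~R) //; ring.
Qed.

(** The rational numbers [N^m a / t^j] with [t] prime to [N] are dense in the reals,
   and small at all primes dividing [beta]. *)
Lemma rat_shift (x y0 e : rat) m : 0 < e -> exists y : rat, [/\ x <= y, y < x + e &
  forall w : absval R K, fin_place w -> w (ratr y0 - ratr y : K) <= 2^-1 ^+ m].
Proof.
move=> e0; have [N [NE N0 _ _]] := norm_int b_int b_gt1.
pose h : int := `|N| ^+ m; pose t : int := `|N| + 1.
have N_gt0 : 0 < `|N| by rewrite normr_gt0.
have h0 : 0 < h by rewrite exprn_gt0.
have tN : coprimez t N.
  apply/coprimezP; exists (1, - Num.sg N); rewrite /= /t normrEsg; ring.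
have t0 : 0 < t by rewrite addr_gt0.
pose j := Num.bound (h%:~R / e : rat).
have he0 : 0 < h%:~R / e :> rat by rewrite divr_gt0 ?ltr0z.
pose s : rat := h%:~R / t%:~R ^+ j.
have s0 : 0 < s by rewrite divr_gt0 ?exprn_gt0 ?ltr0z.
have se : s < e.
  rewrite /s ltr_pdivrMr ?exprn_gt0 ?ltr0z // mulrC -ltr_pdivrMr //.
  apply: (lt_trans (archi_boundP (ltW he0))); rewrite -/j.
  apply: (@lt_le_trans _ _ (2 ^+ j)); first by rewrite -natrX ltr_nat ltn_expl.
  rewrite lerXn2r ?nnegrE ?ler0z ?(ltW t0) // -[2]/(2%:Z%:~R) ler_int.
  by rewrite /t; lia.
pose a := Num.ceil ((x - y0) / s).
have a1 : x - y0 <= a%:~R * s by rewrite -ler_pdivrMr // ceil_ge.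
have a2 : a%:~R * s < x - y0 + s.
  have := ceilB1_lt ((x - y0) / s); rewrite -/a intrB ltr_pdivlMr // mulrBl mul1r.
  by rewrite ltrBlDr.
exists (y0 + a%:~R * s); split; first by lra.
  by lra.
move=> w fw; case: (fw) => -[wU _ _] _.
have -> : ratr y0 - ratr (y0 + a%:~R * s) = - (a * h)%:~R / (t ^+ j)%:~R :> K.
  rewrite ratrD_Qbeta opprD addrA subrr add0r mulNr; congr (- _).
  apply: ratr_frac; first by rewrite expf_neq0 // gt_eqF.
  rewrite intrM (_ : (t ^+ j)%:~R = t%:~R ^+ j :> rat); last exact: rmorphXn.
  by rewrite mulrA.
rewrite absvM absvV (_ : (t ^+ j)%:~R = t%:~R ^+ j :> K); last exact: rmorphXn.
rewrite absvX absvN intrM absvM (fin_place_coprime fw NE tN).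
rewrite expr1n invr1 mulr1.
rewrite -[leRHS]mul1r; apply: ler_pM; rewrite ?absv_ge0 ?ultra_int //.
rewrite /h rmorphXn /= absvX lerXn2r ?nnegrE ?absv_ge0 ?invr_ge0 //.
have -> : w `|N|%:~R = w N%:~R.
  by rewrite -{2}(mulr_sg_norm N) intrM absvM; case: sgrP N0 => //; rewrite ?mulrN1z ?absvN absv1 mul1r.
by apply: fin_place_norm NE => //; case: hb.
Qed.

(** A rational prime dividing both the denominator of [y] and the norm would make [y]
   large at a prime above it. *)
Lemma ZN_of_fin_places (y : rat) :
  (forall l N, prime l -> N%:~R = alg_norm b -> (l %| N)%Z ->
    exists w : absval R K, [/\ fin_place w, w l%:R < 1 & w (ratr y) <= 1]) -> ZN b y.
Proof.
move=> wl; have [N [NE N0 _ _]] := norm_int b_int b_gt1.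
exists (numq y), (denq y), N; split=> //; first by rewrite divq_num_den.
rewrite /coprimez; apply/eqP/eqP; apply: contraT => g1.
set g := absz (gcdz (denq y) N).
have g_gt1 : (1 < g)%N.
  rewrite ltn_neqAle absz_gt0 gcdz_eq0 negb_and N0 orbT andbT.
  by apply: contra g1 => /eqP g1; rewrite -[gcdz _ _]gez0_abs // -/g -g1.
have lp := pdiv_prime g_gt1; set l := pdiv g in lp.
have lg : (l %| gcdz (denq y) N)%Z by rewrite dvdzE; apply: pdiv_dvd.
have [ld lN] : (l %| denq y)%Z /\ (l %| N)%Z by apply/andP; rewrite -dvdz_gcd.
have [w [fw wl1 wy]] := wl l N lp NE lN; case: (fw) => -[wU _ _] _.
have num1 : w (numq y)%:~R = 1.
  apply: (ultra_coprime wU (n := l)) => //.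
  have := coprime_num_den y; rewrite coprimezE => cnd.
  by apply: coprime_dvdr cnd; rewrite dvdzE in ld.
have den1 : w (denq y)%:~R < 1.
  have /dvdzP[c ->] := ld; rewrite intrM absvM; apply: le_lt_trans wl1.
  by rewrite ler_piMl ?absv_ge0 ?ultra_int.
move: wy; rewrite (ratr_frac (denq_neq0 y) (esym (divq_num_den y))).
rewrite absvM num1 mul1r absvV invf_le1 ?leNgt ?den1 //.
by rewrite lt_neqAle absv_ge0 andbT eq_sym absv_eq0 intr_Qbeta_eq0 denq_neq0.
Qed.

End PurelyPeriodicTiles.

(** * The bound for gamma *)

Section Gamma.
Variables (R : realType) (b : R).
Hypothesis hb : pisot b.

Local Notation K := (Qbeta b).

Let b_gt1 : 1 < b. Proof. by case: hb. Qed.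
Let b_int : integralOver (intr : int -> R) b. Proof. by case: hb. Qed.

(** For [v <= x < hat v] the point [delta' (v - x)] lies in [Z'], as [x] is a limit of
   integers at the primes dividing [beta]; if it lies in the tile of [v], then [x] is
   a null point, and otherwise [x] is exceptional. *)
Lemma ZN_pure_or_exceptional (x : rat) : ZN b x -> 0 <= (ratr x : R) < 1 ->
  Pur b (ratr x) \/ exists2 v : K, V b (Qval v) & exceptional v (ratr x).
Proof.
move=> Zx x01; have [v [Vv vx xv]] := V_cover hb x01.
have v01 := V_itv hb Vv; have Zv := V_Qbeta_Zbeta hb Vv.
have vx' : Qval v <= Qval (ratr x : K) by rewrite Qval_rat.
have xv' : Qval (ratr x : K) < hat b (Qval v) by rewrite Qval_rat.
have [tv|ntv] := pselect (tile v (delta' (v - ratr x))).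
  left; have nx := tile_null_point hb v01 vx' xv' tv.
  have [p [q [N [q0 xE _ _]]]] := Zx.
  have -> : (ratr x : R) = Qval (ratr x : K) by rewrite Qval_rat.
  apply: (null_point_pure hb _ q0 (p := p)) => //; first by rewrite Qval_rat.
  by rewrite (ratr_frac b q0 xE) mulrC divfK // intr_Qbeta_eq0.
right; exists v => //; exists x => //; split; first by rewrite vx xv.
exists (delta' (v - ratr x)) => //; split=> //; split=> //.
exact: ZN_closure.
Qed.

(** The complement of the tile is open.  Density of the rationals moves the component
   at the finite primes, and then adding a number [N^m a / t^j] brings the rational
   number next to [x] on the real line without disturbing that component. *)
Lemma exceptional_ZN_approx (v : K) (x : rat) (r : R) :
  closure (delta_f b @` range (ratr : rat -> K)) = [set: Kf b] ->
  V b (Qval v) -> Qval v <= ratr x -> ratr x < hat b (Qval v) ->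
  (@pi_inf' R b @` (@Z' R b `\` tile v)) (delta_inf' (v - ratr x)) -> ratr x < r ->
  exists y : rat, [/\ ZN b y, ratr x <= (ratr y : R) < r, ratr y < hat b (Qval v)
    & ~ tile v (delta' (v - ratr y))].
Proof.
move=> dense Vv vx xv [[z1 z2] [[_ Zz] zv] z1E] xr.
rewrite /pi_inf' /= in z1E; subst z1; rewrite /= in Zz.
have v01 := V_itv hb Vv; have sZ := Zbeta_subring b; have Zv := V_Qbeta_Zbeta hb Vv.
have [[A B] [/= nA nB] AB] : nbhs (delta_inf' (v - ratr x), z2) (~` tile v).
  apply: open_nbhs_nbhs; split=> //; rewrite openC (tileE hb) //.
  exact: closed_closure.
have [_ [[c Zc <-] Bc]] := Zz _ (nbhs_interior nB).
have /closure_imageP[G [PG Grat Gcv]] :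
  closure (delta_f b @` range (ratr : rat -> K)) (delta_f b (v - c)) by rewrite dense.
have Gw w : fin_place w -> forall e : R, 0 < e -> \forall y \near G, w (v - c - y) < e.
  by have [cv _] := cvg_delta_f id (v - c) (G := G) _; exact: cv Gcv w.
have GB : G [set y | (interior B) (delta_f b (v - y))].
  have [_ cv] := cvg_delta_f (fun y => v - y) c (G := G) _.
  apply: cv (nbhs_interior Bc) => w fw e e0; apply: filterS (Gw w fw e e0) => y.
  by rewrite -absvN (_ : - (v - c - y) = c - (v - y)) //; ring.
have [N [NE N0 _ _]] := norm_int b_int b_gt1.
have Gl : G [set y | forall l, l \in primes `|N|%N ->
    exists w : absval R K, [/\ fin_place w, w l%:R < 1 & w y <= 1]].
  have prN l : l \in primes `|N|%N -> exists2 w : absval R K, fin_place w & w l%:R < 1.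
    rewrite mem_primes => /and3P[l_prime _ lN].
    by apply: (prime_norm_fin_place b_int b_gt1 NE l_prime); rewrite dvdzE.
  elim: (primes _) prN => [|l s IH] prN; first by apply: filterE.
  have [w fw wl] := prN l (mem_head _ _).
  have Gs : G [set y | forall l, l \in s ->
      exists w : absval R K, [/\ fin_place w, w l%:R < 1 & w y <= 1]].
    by apply: IH => l' l's; apply: prN; rewrite inE l's orbT.
  apply: filterS2 Gs (Gw w fw 1 ltr01) => y ys wy l'; rewrite inE => /orP[/eqP->|/ys//].
  exists w; split=> //; have -> : y = v - c - (v - c - y) by ring.
  have [[wU _ _] _] := fw; case: (ultra_subring wU) => _ wB _; apply: wB; last exact: ltW.
  by apply: fin_place_Zbeta => //; case: sZ => _ ZB _; apply: ZB.
have [_ [[[q0 _ <-] By0] y0l]] := filter_ex (filterI (filterI Grat GB) Gl).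
have e_gt0 m : 0 < m.+1%:R^-1 :> rat by rewrite invr_gt0 ltr0n.
have /choice[y yP] := fun m => rat_shift hb x q0 m (e_gt0 m).
have yx m : 0 <= (ratr (y m) : R) - ratr x < m.+1%:R^-1.
  have [xy ye _] := yP m; rewrite subr_ge0 ler_rat xy /= ltrBlDl.
  rewrite (_ : m.+1%:R^-1 = ratr m.+1%:R^-1); last by rewrite fmorphV /= ratr_nat.
  by rewrite -rmorphD /= ltr_rat.
have near_e (e : R) : 0 < e -> \forall m \near \oo, ratr (y m) - ratr x < e.
  move=> e0; have := near_infty_natSinv_lt (PosNum e0); apply: filterS => m /=.
  by apply: lt_trans; case/andP: (yx m).
have nearA : \forall m \near \oo, A (@delta_inf' R b (v - ratr (y m))).
  have [_ cv] := cvg_delta_inf' (fun m => v - ratr (y m)) (v - ratr x) (G := \oo) _.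
  apply: cv nA => w iw np1 e e0; apply: filterS (near_e e e0) => m.
  have -> : v - ratr x - (v - ratr (y m)) = ratr (y m - x).
    rewrite (_ : ratr (y m) = ratr (y m - x) + ratr x :> K); first by ring.
    by rewrite -ratrD_Qbeta subrK.
  rewrite absv_infinite_rat // rmorphB /= ger0_norm //.
  by case/andP: (yx m).
have nearB : \forall m \near \oo, B (delta_f b (v - ratr (y m))).
  have [_ cv] := cvg_delta_f (fun m => v - ratr (y m)) (v - ratr q0) (G := \oo) _.
  apply: cv By0 => w fw e e0.
  have half : `|2^-1 : R| < 1 by rewrite ger0_norm ?invr_ge0 // invf_lt1 // ltr1n.
  have /cvgr0Pnorm_lt/(_ e e0) := cvg_expr half.
  apply: filterS => m; rewrite ger0_norm ?exprn_ge0 ?invr_ge0 //; apply: le_lt_trans.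
  have [_ _ /(_ w fw)] := yP m; apply: le_trans; rewrite absv_distC.
  by rewrite (_ : v - ratr (y m) - (v - ratr q0) = ratr q0 - ratr (y m)) //; ring.
have xr0 : 0 < r - ratr x by rewrite subr_gt0.
have xv0 : 0 < hat b (Qval v) - ratr x by rewrite subr_gt0.
have [m [[[Am Bm] mr] mv]] :=
  filter_ex (filterI (filterI (filterI nearA nearB) (near_e _ xr0)) (near_e _ xv0)).
exists (y m); split.
- apply: (ZN_of_fin_places hb) => l N' l_prime N'E lN'.
  have NN' : N' = N by apply/eqP; rewrite -(eqr_int R[i]) NE N'E.
  have [|w [fw wl wq]] := y0l l.
    by rewrite mem_primes l_prime absz_gt0 N0 -NN'; move: lN'; rewrite dvdzE.
  exists w; split=> //; have -> : ratr (y m) = ratr q0 - (ratr q0 - ratr (y m)) :> K by ring.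
  have [[wU _ _] _] := fw; case: (ultra_subring wU) => _ wB _; apply: wB => //=.
  have [_ _ /(_ w fw)] := yP m => /le_trans; apply.
  by rewrite exprn_ile1 ?invr_ge0 // invf_le1 // ler1n.
- by have [xy _ _] := yP m; rewrite ler_rat xy /=; move: mr => /=; lra.
- by move: mv => /=; lra.
- by move=> tv; apply: (AB (delta' (v - ratr (y m)))).
Qed.

Lemma exceptional_itv (v : K) (e : R) : V b (Qval v) -> exceptional v e -> 0 <= e < 1.
Proof.
move=> Vv [x [/andP[vx xv] _] <-]; have /andP[v0 v1] := V_itv hb Vv.
by rewrite (le_trans v0) //= (lt_le_trans xv) // hat_le1.
Qed.

End Gamma.

Theorem theorem5 (R : realType) (b : R) (hb : pisot b) :
  inf ([set 1] `|` \bigcup_(v in [set v : Qbeta b | V b (Qval v)])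
                     exceptional v) <= gamma b /\
  (closure (delta_f b @` range (ratr : rat -> Qbeta b)) = [set: Kf b] ->
   gamma b = inf ([set 1] `|` \bigcup_(v in [set v : Qbeta b | V b (Qval v)])
                                exceptional v)).
Proof.
set E := _ `|` _.
have E_ge0 e : E e -> 0 <= e.
  by move=> [->|[v Vv /(exceptional_itv hb Vv)/andP[]]]; rewrite ?ler01.
have E_lb : has_lbound E by exists 0 => e /E_ge0.
have E_n0 : E !=set0 by exists 1; left.
pose S := [set r : R | 0 <= r <= 1 /\
    forall x : rat, ZN b x -> 0 <= (ratr x : R) < r -> Pur b (ratr x)].
have lower : inf E <= gamma b.
  have infE1 : inf E <= 1 by apply: ge_inf => //; left.
  have infE0 : 0 <= inf E by apply: lb_le_inf.
  apply: (@ub_le_sup _ S); first by exists 1 => r [/andP[]].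
  split=> [|x Zx /andP[x0 xI]]; first by rewrite infE0.
  have [|//|[v Vv vx]] := ZN_pure_or_exceptional hb Zx.
    by rewrite x0 (lt_le_trans xI).
  by move: xI; rewrite ltNge ge_inf //; right; exists v.
split=> // dense; apply/eqP; rewrite eq_le lower andbT.
apply: (@ge_sup _ S).
  exists 0; split; first by rewrite lexx ler01.
  by move=> x _ /andP[x0]; rewrite ltNge x0.
move=> r [/andP[r0 r1] rP]; apply: lb_le_inf => // e [->//|[v Vv [x [/andP[vx xv] xe] <-]]].
rewrite leNgt; apply/negP => xr.
have [y [Zy /andP[xy yr] yv ny]] := exceptional_ZN_approx hb dense Vv vx xv xe xr.
have /andP[v0 v1] := V_itv hb Vv.
apply: ny; apply: (pure_tile hb); rewrite ?Qval_rat ?v0 //.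
  exact: le_trans xy.
by apply: rP => //; rewrite (le_trans v0) // (le_trans vx).
Qed.
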